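(* Let $\sigma,\tau\in\mathbb{R}$ and let $p(V):=V^2+\sigma V+\tau I$, where $V$ is the Volterra operator on $L^2[0,1]$. For $\delta>0$, let $\omega_1=\omega_1(\delta)$ and $\omega_2=\omega_2(\delta)$ be the unique positive solutions of \[ \delta\omega_1^4+(\sigma^2-2\tau)\omega_1^2-1=0,\qquad \delta\omega_2^4-(\sigma^2-2\tau)\omega_2^2-1=0, \] and define \[ \begin{aligned} \Omega_0&:=\cosh\omega_1-\cos\omega_2,\\ \Omega_1&:=\omega_1\sinh\omega_1+\omega_2\sin\omega_2,\\ \Omega_2&:=\omega_1^2\cosh\omega_1+\omega_2^2\cos\omega_2,\\ \Omega_3&:=\omega_1^3\sinh\omega_1-\omega_2^3\sin\omega_2. \end{aligned} \] Consider the following equation in the unknown $\delta>0$: \[ \begin{aligned} &\bigl(\tau\Omega_0+\sigma\tau\Omega_1-\delta\Omega_2\bigr) \bigl((\tau-\sigma^2)\Omega_0-\sigma(\sigma^2-2\tau)\Omega_1-\delta\Omega_2-\sigma\delta\Omega_3\bigr)\\ &-\bigl(\sigma\tau\Omega_0+(\sigma^2\tau-2\tau^2-\delta)\Omega_1+\tau\delta\Omega_3\bigr)\bigl(-\sigma\Omega_0+(\tau-\sigma^2)\Omega_1-\delta\Omega_3\bigr)=0. \end{aligned} \] Then $\|p(V)\|=\sqrt{\tau^2+\delta}$, where $\delta$ is the largest positive solution of this equation. If no positive solution exists, then $\|p(V)\|=|\tau|$.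
   Context: $L^2[0,1]$ is the complex Hilbert space of square-integrable functions on $[0,1]$. The Volterra operator $V:L^2[0,1]\to L^2[0,1]$ is defined by $Vf(x):=\int_0^x f(t)\,dt$. $I$ is the identity operator and $\|\cdot\|$ denotes the operator norm on $L^2[0,1]$. *)

(* Defs.v *)
From HB Require Import structures.
From mathcomp Require Import all_boot all_order all_algebra.
From mathcomp Require Import all_classical all_reals all_analysis.
From mathcomp Require Import complex.
Set Implicit Arguments.
Unset Strict Implicit.
Unset Printing Implicit Defensive.
Import Order.TTheory GRing.Theory Num.Theory.
Import numFieldNormedType.Exports.
Local Open Scope classical_set_scope.
Local Open Scope complex_scope.
Local Open Scope ring_scope.

(* Elements of the complex space L^2[0,1] are represented by functions
   [R -> R[i]], of which only the restriction to [0, 1] matters. No quotient by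
   almost-everywhere equality is taken: [L2norm] and [volterra] do not
   distinguish functions that agree almost everywhere on [0, 1]. Measurability is
   Borel measurability, as every class of L^2[0,1] has a Borel representative. *)

Definition L2norm (R : realType) (f : R -> R[i]) : \bar R :=
  ((\int[lebesgue_measure]_(x in `[0%R, 1%R]) (Normc.normc (f x) ^+ 2)%:E)
     `^ (2%R)^-1)%E.

Definition inL2 (R : realType) (f : R -> R[i]) : Prop :=
  [/\ measurable_fun `[0 : R, 1] (fun x => complex.Re (f x)),
      measurable_fun `[0 : R, 1] (fun x => complex.Im (f x)) &
      (L2norm f < +oo)%E].

(* The supremum is taken in the extended reals, so that a statement
   [opnorm T = r%:E] includes the boundedness of [T]. *)
Definition opnorm (R : realType) (T : (R -> R[i]) -> (R -> R[i])) : \bar R :=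
  ereal_sup [set L2norm (T f) | f in [set f | inL2 f /\ (L2norm f <= 1)%E]].

Definition volterra (R : realType) (f : R -> R[i]) : R -> R[i] := fun x =>
  (\int[lebesgue_measure]_(t in `[0, x]) complex.Re (f t)) +i*
  (\int[lebesgue_measure]_(t in `[0, x]) complex.Im (f t)).

Definition pV (R : realType) (sigma tau : R) (f : R -> R[i]) : R -> R[i] :=
  fun x => volterra (volterra f) x + sigma%:C * volterra f x + tau%:C * f x.

Definition cosh (R : realType) (x : R) : R := (expR x + expR (- x)) / 2.
Definition sinh (R : realType) (x : R) : R := (expR x - expR (- x)) / 2.

Definition is_omega1 (R : realType) (sigma tau delta w : R) : Prop :=
  0 < w /\ delta * w ^+ 4 + (sigma ^+ 2 - 2 * tau) * w ^+ 2 - 1 = 0.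
Definition is_omega2 (R : realType) (sigma tau delta w : R) : Prop :=
  0 < w /\ delta * w ^+ 4 - (sigma ^+ 2 - 2 * tau) * w ^+ 2 - 1 = 0.

(* [xget 0 A] is an element of [A] if there is one, and 0 otherwise. *)
Definition omega1 (R : realType) (sigma tau delta : R) : R :=
  xget 0 [set w | is_omega1 sigma tau delta w].
Definition omega2 (R : realType) (sigma tau delta : R) : R :=
  xget 0 [set w | is_omega2 sigma tau delta w].

Definition Omega0 (R : realType) (w1 w2 : R) : R := cosh w1 - cos w2.
Definition Omega1 (R : realType) (w1 w2 : R) : R :=
  w1 * sinh w1 + w2 * sin w2.
Definition Omega2 (R : realType) (w1 w2 : R) : R :=
  w1 ^+ 2 * cosh w1 + w2 ^+ 2 * cos w2.
Definition Omega3 (R : realType) (w1 w2 : R) : R :=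
  w1 ^+ 3 * sinh w1 - w2 ^+ 3 * sin w2.

Definition char_fun (R : realType) (sigma tau delta : R) : R :=
  let w1 := omega1 sigma tau delta in
  let w2 := omega2 sigma tau delta in
  let O0 := Omega0 w1 w2 in
  let O1 := Omega1 w1 w2 in
  let O2 := Omega2 w1 w2 in
  let O3 := Omega3 w1 w2 in
  (tau * O0 + sigma * tau * O1 - delta * O2) *
  ((tau - sigma ^+ 2) * O0 - sigma * (sigma ^+ 2 - 2 * tau) * O1
     - delta * O2 - sigma * delta * O3)
  - (sigma * tau * O0 + (sigma ^+ 2 * tau - 2 * tau ^+ 2 - delta) * O1
       + tau * delta * O3) *
    (- sigma * O0 + (tau - sigma ^+ 2) * O1 - delta * O3).

Definition positive_solution (R : realType) (sigma tau delta : R) : Prop :=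
  0 < delta /\ char_fun sigma tau delta = 0.

Definition largest_positive_solution (R : realType) (sigma tau delta : R) :
    Prop :=
  positive_solution sigma tau delta /\
  forall delta', positive_solution sigma tau delta' -> delta' <= delta.

(* Main.v *)
(* Put T = V^2 + sigma V + tau on real L^2[0,1] (T acts separately on real and
   imaginary parts), s = sigma^2 - 2 tau, and let
   q(f, g) = (tau^2 + delta) <f, g> - <T f, T g>.
   The relation <f, V g> + <V f, g> = (V f)(1) (V g)(1), i.e. that V + V^* has
   rank one, gives q(f, g) = <D f, g> - bc0(f) (V^2 g)(1) - bc1(f) (V g)(1)
   with D = delta + s V^2 - V^4 = delta (1 - w1^2 V^2) (1 + w2^2 V^2), where
   w1, w2 are the omegas. D is invertible by an explicit Volterra resolvent. On
   the span of the second derivatives of the solutions of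
   delta u^(4) + s u^(2) = u with u(0) = u^(1)(0) = 0, D takes values in the affine
   functions, and q reduces to a 2 x 2 matrix whose determinant is the
   characteristic function. If the determinant vanishes, some nonzero h satisfies
   q(h, h) = 0, whence ||T||^2 >= tau^2 + delta. If it does not, then
   q(G f, .) = delta <f, .> has a bounded solution operator G, and when q is
   positive semidefinite, q(f - t G f, f - t G f) >= 0 with a suitable t shows
   q(f, f) >= e ||f||^2 for some e > 0; hence delta = ||T||^2 - tau^2, if positive,
   is a solution, and then the largest one. That ||T|| >= |tau| is tested on
   indicators of short intervals. *)
Require Import Defs.
From HB Require Import structures.
From mathcomp Require Import all_boot all_order all_algebra.
From mathcomp Require Import all_classical all_reals all_analysis.
From mathcomp Require Import measurable_realfun complex.
From mathcomp Require Import ring lra.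
Import Order.TTheory GRing.Theory Num.Theory.
Import numFieldNormedType.Exports.
Local Open Scope classical_set_scope.
Local Open Scope ring_scope.
Set Implicit Arguments.
Unset Strict Implicit.
Unset Printing Implicit Defensive.

(** * Integrability of real-valued functions *)

Section RealIntegrable.
Context d {T : measurableType d} {R : realType}.
Variable mu : {measure set T -> \bar R}.
Implicit Types (D : set T) (f g : T -> R).

Lemma integrable_add D f g : measurable D -> mu.-integrable D (EFin \o f) ->
  mu.-integrable D (EFin \o g) -> mu.-integrable D (EFin \o (fun x => f x + g x)).
Proof. by move=> mD fi gi; exact: (integrableD mD fi gi). Qed.

Lemma integrable_scale D f a : measurable D -> mu.-integrable D (EFin \o f) ->
  mu.-integrable D (EFin \o (fun x => a * f x)).
Proof. by move=> mD fi; exact: (integrableZl mD _ fi). Qed.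

Lemma integrable_dominated D f g : measurable D -> measurable_fun D f ->
  (forall x, D x -> `|f x| <= g x) ->
  mu.-integrable D (EFin \o g) -> mu.-integrable D (EFin \o f).
Proof.
move=> mD mf fg gi; apply: (le_integrable mD _ _ gi); first exact/measurable_EFinP.
by move=> x Dx /=; rewrite lee_fin (le_trans (fg _ Dx))// ler_norm.
Qed.

Lemma EFin_Rintegral D f : measurable D -> mu.-integrable D (EFin \o f) ->
  (\int[mu]_(x in D) (f x)%:E = (\int[mu]_(x in D) f x)%:E)%E.
Proof. by move=> mD fi; rewrite fineK//; exact: integrable_fin_num. Qed.

Lemma integrable_patch D f : measurable D -> mu.-integrable D (EFin \o f) ->
  mu.-integrable setT (EFin \o (f \_ D)).
Proof. by move=> mD fi; rewrite -restrict_EFin; exact: (integrable_mkcond _ mD).1. Qed.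

End RealIntegrable.

(** * The real space L^2[0,1], its inner product and the Volterra operator *)

HB.lock Definition V (R : realType) (f : R -> R) (x : R) : R :=
  \int[@lebesgue_measure R]_(t in `[0, x]) f t.

(** [V] and [ip] are locked so that unification does not unfold iterates such as [V (V f)] into
    integrals. *)
HB.lock Definition ip (R : realType) (f g : R -> R) : R :=
  \int[@lebesgue_measure R]_(x in `[0, 1]) (f x * g x).

Arguments V {R} f x.
Arguments ip {R} f g.

Section RealL2.
Local Open Scope classical_set_scope.
Context {R : realType}.
Local Notation mu := (@lebesgue_measure R).
Local Notation I := (`[0%R, 1%R]%classic : set R).
Implicit Types (f g h : R -> R) (x y a b c : R).

Definition rL2 f := measurable_fun (I : set (measurableTypeR R)) f /\
  mu.-integrable I (EFin \o (fun x => f x ^+ 2)).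


Lemma mem_I x : (x \in I) = (0 <= x <= 1).
Proof. by rewrite mem_setE in_itv. Qed.

Lemma I_itv x : I x = (0 <= x <= 1) :> Prop.
Proof. by rewrite /= in_itv. Qed.

Lemma mu_I : (mu I < +oo)%E.
Proof. by rewrite lebesgue_measure_itv/= lte_fin ltr01 -EFinD ltry. Qed.

Lemma sub_I x : 0 <= x <= 1 -> `[0, x] `<=` I.
Proof.
by move=> /andP[_ x1] y; rewrite /= !in_itv/= => /andP[-> yx]; exact: le_trans yx x1.
Qed.

(** The product is dominated by [f ^+ 2 + g ^+ 2]. *)
Lemma rL2_integrableM f g : rL2 f -> rL2 g ->
  mu.-integrable I (EFin \o (fun x => f x * g x)).
Proof.
move=> [mf f2] [mg g2].
apply: (integrable_dominated _ _ _ (integrable_add _ f2 g2)) => //.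
  exact: measurable_funM.
move=> x _; rewrite ler_norml; apply/andP; split; nra.
Qed.

Lemma rL2_bounded f B : measurable_fun (I : set (measurableTypeR R)) f ->
  (forall x, 0 <= x <= 1 -> `|f x| <= B) -> rL2 f.
Proof.
move=> mf fB; split => //.
apply: measurable_bounded_integrable => //; first exact: mu_I.
  by apply: measurable_funX.
exists (B ^+ 2); split; first exact: num_real.
move=> M BM x; rewrite I_itv => Ix; rewrite /= normrX (le_trans _ (ltW BM))//.
by rewrite lerXn2r ?nnegrE// ?fB// (le_trans _ (fB _ Ix)).
Qed.

Lemma rL2_cst c : rL2 (cst c).
Proof. by apply: (@rL2_bounded _ `|c|) => //=; exact: measurable_cst. Qed.

Lemma rL2_integrable f : rL2 f -> mu.-integrable I (EFin \o f).
Proof.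
move=> /rL2_integrableM /(_ (rL2_cst 1)).
by congr (_.-integrable _ _); apply/funext => x /=; rewrite mulr1.
Qed.

Lemma rL2_integrable0 f x : rL2 f -> 0 <= x <= 1 -> mu.-integrable `[0, x] (EFin \o f).
Proof.
move=> /rL2_integrable + /sub_I; move=> /integrableS; apply => //.
Qed.

Lemma rL2_continuous f : {within I, continuous f} -> rL2 f.
Proof.
move=> cf; split.
  by apply: subspace_continuous_measurable_fun.
apply: continuous_compact_integrable; first exact: segment_compact.
by move=> x; apply: continuousM; exact: cf.
Qed.

Lemma VE f x : V f x = \int[mu]_(t in `[0, x]) f t.
Proof. by rewrite V.unlock. Qed.

Lemma ipE f g : ip f g = \int[mu]_(x in I) (f x * g x).
Proof. by rewrite ip.unlock. Qed.

Lemma rL2_V f : rL2 f -> rL2 (V f).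
Proof.
move=> f2; apply: rL2_continuous; rewrite V.unlock.
exact: parameterized_integral_continuous (rL2_integrable _).
Qed.

(** The shape [f + a * g] covers sums, differences and linear combinations at once; [VD], [ipDl] and
    [qformDl] share it. *)
Lemma rL2D f g a : rL2 f -> rL2 g -> rL2 (fun x => f x + a * g x).
Proof.
move=> [mf f2] [mg g2]; split.
  by apply: measurable_funD => //; apply: measurable_funM.
have i3 : mu.-integrable I (EFin \o (fun x =>
    f x ^+ 2 + (2 * a) * (f x * g x) + a ^+ 2 * g x ^+ 2)).
  apply: integrable_add; [exact: measurable_itv| |exact: integrable_scale].
  apply: integrable_add; [exact: measurable_itv|by []|].
  by apply: integrable_scale => //; exact: rL2_integrableM.
by apply: eq_integrable i3 => // x _ /=; congr EFin; ring.
Qed.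

Lemma rL2M f g B : measurable_fun (I : set (measurableTypeR R)) g ->
  (forall x, 0 <= x <= 1 -> `|g x| <= B) -> rL2 f -> rL2 (fun x => g x * f x).
Proof.
move=> mg gB [mf f2]; split; first exact: measurable_funM.
apply: (integrable_dominated _ _ _ (integrable_scale (B ^+ 2) _ f2)) => //.
  by apply: measurable_funX; exact: measurable_funM.
move=> x; rewrite I_itv => /gB gBx /=.
rewrite ger0_norm ?sqr_ge0// exprMn ler_wpM2r ?sqr_ge0// -real_normK ?num_real//.
by rewrite lerXn2r ?nnegrE// (le_trans _ gBx).
Qed.

Lemma rL2_eq f g : (forall x, 0 <= x <= 1 -> f x = g x) -> rL2 f -> rL2 g.
Proof.
move=> fg [mf f2]; split.
  by apply: eq_measurable_fun mf => x; rewrite mem_I => /fg.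
by apply: eq_integrable f2 => // x; rewrite mem_I => /fg /= ->.
Qed.

Lemma eq_V f g x : 0 <= x <= 1 -> (forall x, 0 <= x <= 1 -> f x = g x) ->
  V f x = V g x.
Proof.
move=> Ix fg; rewrite !VE; apply: eq_Rintegral => y; rewrite inE => /(sub_I Ix).
by rewrite I_itv => /fg.
Qed.

Lemma VD f g a x : 0 <= x <= 1 -> rL2 f -> rL2 g ->
  V (fun x => f x + a * g x) x = V f x + a * V g x.
Proof.
move=> Ix f2 g2; rewrite !VE -RintegralZl//; last exact: rL2_integrable0.
rewrite -RintegralD//; first exact: rL2_integrable0.
by apply: integrable_scale => //; exact: rL2_integrable0.
Qed.

Lemma eq_ip f f' g g' : (forall x, 0 <= x <= 1 -> f x = f' x) ->
  (forall x, 0 <= x <= 1 -> g x = g' x) -> ip f g = ip f' g'.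
Proof.
move=> ff' gg'; rewrite !ipE; apply: eq_Rintegral => x.
by rewrite mem_I => Ix; rewrite ff' ?gg'.
Qed.

Lemma ipC f g : ip f g = ip g f.
Proof. by rewrite !ipE; apply: eq_Rintegral => x _; rewrite mulrC. Qed.

Lemma ipDl f g h a : rL2 f -> rL2 g -> rL2 h ->
  ip (fun x => f x + a * g x) h = ip f h + a * ip g h.
Proof.
move=> f2 g2 h2; rewrite !ipE -RintegralZl//; last exact: rL2_integrableM.
rewrite -RintegralD//; [|exact: rL2_integrableM|]; last first.
  by apply: integrable_scale => //; exact: rL2_integrableM.
by apply: eq_Rintegral => x _; rewrite mulrDl mulrA.
Qed.

Lemma ipDr f g h a : rL2 f -> rL2 g -> rL2 h ->
  ip h (fun x => f x + a * g x) = ip h f + a * ip h g.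
Proof. by move=> *; rewrite ipC ipDl// !(ipC h). Qed.

Lemma ip_ge0 f : 0 <= ip f f.
Proof. by rewrite ipE; apply: Rintegral_ge0 => x _; rewrite -expr2 sqr_ge0. Qed.

Lemma ip1 f : ip (cst 1) f = V f 1.
Proof. by rewrite ipE VE; apply: eq_Rintegral => x _; rewrite mul1r. Qed.

Lemma le_ip f f' g g' : rL2 f -> rL2 f' -> rL2 g -> rL2 g' ->
  (forall x, 0 <= x <= 1 -> f x * g x <= f' x * g' x) -> ip f g <= ip f' g'.
Proof.
move=> f2 f'2 g2 g'2 fg; rewrite !ipE.
apply: le_Rintegral.
- exact: measurable_itv.
- exact: rL2_integrableM.
- exact: rL2_integrableM.
- by move=> x; rewrite I_itv => /fg.
Qed.

Lemma V_cst c x : 0 <= x -> V (cst c) x = c * x.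
Proof.
move=> x0; rewrite VE Rintegral_cst//; congr (_ * _).
rewrite [LHS](_ : _ = fine (mu `[0, x]))// lebesgue_measure_itv/= lte_fin.
by case: ltP => [_|x0']; [rewrite /= subr0|apply/le_anti; rewrite x0].
Qed.

(* Expand [0 <= \int_0^x (f - V f x)^2]. *)
Lemma sqr_V_le f x : rL2 f -> 0 <= x <= 1 -> V f x ^+ 2 <= ip f f.
Proof.
move=> f2 Ix; have /andP[x0 x1] := Ix.
have i2 : mu.-integrable I (EFin \o (fun x => f x ^+ 2)) by case: f2.
have i2x : mu.-integrable `[0, x] (EFin \o (fun x => f x ^+ 2)).
  by apply: integrableS i2 => //; exact: sub_I.
have ic c : mu.-integrable `[0, x] (EFin \o cst c).
  by apply: rL2_integrable0 => //; exact: rL2_cst.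
have : 0 <= \int[mu]_(t in `[0, x]) ((f t - V f x) ^+ 2).
  by apply: Rintegral_ge0 => t _; exact: sqr_ge0.
have -> : \int[mu]_(t in `[0, x]) ((f t - V f x) ^+ 2) =
   \int[mu]_(t in `[0, x]) ((f t ^+ 2 + (- 2 * V f x) * f t) + V f x ^+ 2).
  by apply: eq_Rintegral => t _; ring.
rewrite RintegralD//; [| |exact: ic]; last first.
  by apply: integrable_add => //; apply: integrable_scale => //; exact: rL2_integrable0.
rewrite RintegralD//; [|apply: integrable_scale => //; exact: rL2_integrable0].
rewrite RintegralZl//; last exact: rL2_integrable0.
rewrite -(VE f) -(VE (cst (V f x ^+ 2))) V_cst//.
have le2 : \int[mu]_(t in `[0, x]) (f t ^+ 2) <= ip f f.
  rewrite ipE; under [leRHS]eq_Rintegral do rewrite -expr2.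
  have H := @Rintegral_itvB R (fun t => f t ^+ 2) (BLeft 0) (BRight 1) x i2.
  rewrite -subr_ge0 H ?bnd_simp//.
  by apply: Rintegral_ge0 => t _; exact: sqr_ge0.
(* With u = [V f x], the expansion says that the integral of f^2 over [0, x] is at least (2 - x)
   u^2, and x is at most 1. *)
move=> h; apply: le_trans le2.
have := sqr_ge0 (V f x); nra.
Qed.

End RealL2.

(** * Integration by parts for the Volterra operator *)

Section IntegrationByParts.
Context {R : realType}.
Local Notation mu := (@lebesgue_measure R).
Local Notation I := (`[0%R, 1%R]%classic : set R).
Implicit Types (f g h : R -> R) (x y a b c : R).

(* Both sides of [V_byparts] come from Fubini on the triangle [t <= s]. *)
Let triangle f g x (s t : measurableTypeR R) : R :=
  if t <= s then (f \_ `[0, x]) s * (g \_ `[0, x]) t else 0.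

Let triangle_integrable f g x : 0 <= x <= 1 -> rL2 f -> rL2 g ->
  (mu \x mu)%E.-integrable setT (EFin \o (fun st => triangle f g x st.1 st.2)).
Proof.
move=> Ix f2 g2.
have fi := rL2_integrable0 f2 Ix; have gi := rL2_integrable0 g2 Ix.
have mf : measurable_fun (setT : set (measurableTypeR R)) (f \_ `[0, x]).
  apply/(measurable_restrictT _ _).1 => //.
  by apply/measurable_EFinP; exact: measurable_int fi.
have mg : measurable_fun (setT : set (measurableTypeR R)) (g \_ `[0, x]).
  apply/(measurable_restrictT _ _).1 => //.
  by apply/measurable_EFinP; exact: measurable_int gi.
have mfg : measurable_fun (setT : set (measurableTypeR R * measurableTypeR R))
    (fun st => (f \_ `[0, x]) st.1 * (g \_ `[0, x]) st.2).
  by apply: measurable_funM; apply: measurableT_comp.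
have mtri : measurable_fun (setT : set (measurableTypeR R * measurableTypeR R))
    (fun st => triangle f g x st.1 st.2).
  apply: measurable_fun_ifT => //.
  exact: measurable_fun_ler.
have fi' : mu.-integrable setT (EFin \o (f \_ `[0, x])).
  exact: integrable_patch.
have gi' : mu.-integrable setT (EFin \o (g \_ `[0, x])).
  exact: integrable_patch.
(* The triangle is dominated by the full product |f(s) g(t)|. Its iterated integral factors into two
   finite integrals, so Tonelli gives integrability on the plane. *)
refine (@integrable_dominated _ _ _ (mu \x mu)%E _ _ 
  (fun st => `|(f \_ `[0, x]) st.1 * (g \_ `[0, x]) st.2|) _ _ _ _) => //.
  by move=> st _; rewrite /triangle; case: ifP => _ //; rewrite normr0.
have mfg' : measurable_fun setT (EFin \o (fun st : measurableTypeR R * measurableTypeR R =>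
    `|(f \_ `[0, x]) st.1 * (g \_ `[0, x]) st.2|)).
  by apply/measurable_EFinP; apply: measurableT_comp.
refine ((@integrable12ltyP _ _ _ _ _ mu mu _ mfg').2 _).
rewrite /=.
under eq_integral => s _.
  under eq_integral => t _ do rewrite normr_id normrM.
  rewrite (@EFin_Rintegral _ _ _ mu _
    (fun t => `|(f \_ `[0, x]) s| * `|(g \_ `[0, x]) t|))//; last first.
    by apply: integrable_scale => //; exact: integrable_norm.
  rewrite RintegralZl//; last exact: integrable_norm.
  over.
rewrite (@EFin_Rintegral _ _ _ mu _ (fun s => `|(f \_ `[0, x]) s| * _))// ?ltry//.
set c := Rintegral _ _ _; rewrite [X in EFin \o X](_ : _ = fun s => c * `|(f \_ `[0, x]) s|).
  by apply: integrable_scale => //; exact: integrable_norm.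
by apply/funext => s; rewrite mulrC.
Qed.

(** For fixed s in [0, x] the section of the triangle is [0, s]. *)
Let triangle_inner1 f g x s : 0 <= x <= 1 -> rL2 g ->
  (\int[mu]_t (triangle f g x s t)%:E =
   (((fun s => f s * V g s) \_ `[0, x]) s)%:E)%E.
Proof.
move=> Ix g2; rewrite patchE mem_setE in_itv/=; case: ifPn => [/andP[s0 sx]|sNx].
  have Is : 0 <= s <= 1 by rewrite s0 (le_trans sx)//; case/andP: Ix.
  have -> : (fun t => (triangle f g x s t)%:E) = EFin \o ((fun t => f s * g t) \_ `[0, s]).
    apply/funext => t; rewrite /triangle/= !patchE !mem_setE !in_itv/= s0 sx /=.
    case: ifPn => [ts|_]; last by rewrite andbF.
    by rewrite (le_trans ts sx) !andbT; case: ifP => _ //; rewrite mulr0.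
  rewrite -restrict_EFin -integral_mkcond EFin_Rintegral//; last first.
    by apply: integrable_scale => //; exact: rL2_integrable0.
  by rewrite RintegralZl// ?VE//; exact: rL2_integrable0.
rewrite integral0_eq// => t _; rewrite /triangle [X in X * _]patchE mem_setE in_itv/=.
by rewrite (negbTE sNx) mul0r if_same.
Qed.

(** For fixed t in [0, x] the section is [t, x], whose integral is a difference of two values of
    [V f]. *)
Let triangle_inner2 f g x t : 0 <= x <= 1 -> rL2 f ->
  (\int[mu]_s (triangle f g x s t)%:E =
   (((fun t => g t * (V f x - V f t)) \_ `[0, x]) t)%:E)%E.
Proof.
move=> Ix f2; rewrite patchE mem_setE in_itv/=; case: ifPn => [/andP[t0 tx]|tNx].
  have -> : (fun s => (triangle f g x s t)%:E) = EFin \o ((fun s => g t * f s) \_ `[t, x]).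
    apply/funext => s; rewrite /triangle/= !patchE !mem_setE !in_itv/= t0 tx /=.
    case: ifPn => [ts|_] //.
    by rewrite (le_trans t0 ts) /=; case: ifP => _; rewrite ?mul0r// mulrC.
  have ftx : mu.-integrable `[t, x] (EFin \o f).
    apply: integrableS (rL2_integrable0 f2 Ix) => // y.
    by rewrite /= !in_itv/= => /andP[/(le_trans t0) -> ->].
  rewrite -restrict_EFin -integral_mkcond EFin_Rintegral//; last exact: integrable_scale.
  rewrite RintegralZl// !VE Rintegral_itvB ?bnd_simp//; last exact: rL2_integrable0.
  (* That difference is an integral over the half-open interval; the endpoint t has measure zero. *)
  rewrite Rintegral_itv_obnd_cbnd//.
  by apply: integrableS ftx => // y; rewrite /= !in_itv/= => /andP[/ltW -> ->].
rewrite integral0_eq// => s _; rewrite /triangle [X in _ * X]patchE mem_setE in_itv/=.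
by rewrite (negbTE tNx) mulr0 if_same.
Qed.

Lemma V_byparts f g x : 0 <= x <= 1 -> rL2 f -> rL2 g ->
  V (fun t => f t * V g t) x + V (fun t => g t * V f t) x = V f x * V g x.
Proof.
move=> Ix f2 g2.
have /(congr1 fine) := Fubini (triangle_integrable Ix f2 g2).
under eq_integral do rewrite triangle_inner1//.
under [in RHS]eq_integral do rewrite triangle_inner2//.
rewrite -!/(Rintegral _ _ _) -!Rintegral_mkcond => E.
have {E} -> : V (fun t => f t * V g t) x = V (fun t => g t * (V f x - V f t)) x.
  by rewrite VE [RHS]VE; exact: E.
have ig a : mu.-integrable `[0, x] (EFin \o (fun t => a * g t)).
  by apply: integrable_scale => //; exact: rL2_integrable0.
have igf : mu.-integrable `[0, x] (EFin \o (fun t => g t * V f t)).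
  by apply: integrableS (rL2_integrableM g2 (rL2_V f2)) => //; exact: sub_I.
have -> : V f x * V g x = V (fun t => V f x * g t) x.
  by rewrite [in LHS](VE g) [RHS]VE -RintegralZl//; exact: rL2_integrable0.
rewrite [X in X + _]VE [X in _ + X]VE [RHS]VE -RintegralD//; last first.
  apply: eq_integrable (integrable_add _ (ig (V f x)) (integrable_scale (-1) _ igf)) => //.
  by move=> t _ /=; congr EFin; ring.
by apply: eq_Rintegral => t _; ring.
Qed.

End IntegrationByParts.

(** * Bounded operators on L^2[0,1] and multiplication by smooth functions *)

Section BoundedOperators.
Context {R : realType}.
Local Notation mu := (@lebesgue_measure R).
Local Notation I := (`[0%R, 1%R]%classic : set R).
Implicit Types (f g h phi psi : R -> R) (x y a b c : R) (S T : (R -> R) -> R -> R).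

Lemma ip_byparts f g : rL2 f -> rL2 g ->
  ip f (V g) + ip (V f) g = V f 1 * V g 1.
Proof.
move=> f2 g2; rewrite (ipC _ g) !ipE -!VE; apply: V_byparts => //.
by rewrite ler01 lexx.
Qed.

Lemma rL2_continuousT f : continuous f -> rL2 f.
Proof. by move=> cf; apply: rL2_continuous; exact: continuous_subspaceT. Qed.

Lemma V_FTC f g x : (forall y, is_derive y (1:R) f (g y)) -> continuous g ->
  0 <= x <= 1 -> V g x = f x - f 0.
Proof.
move=> fg cg /andP[]; rewrite le_eqVlt => /predU1P[<- _|x0 x1].
  by rewrite VE set_itv1 Rintegral_set1 subrr.
have cf : continuous f.
  by move=> y; apply/differentiable_continuous/derivable1_diffP; case: (fg y).
rewrite VE /Rintegral (@continuous_FTC2 _ g f)//.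
- exact: continuous_subspaceT.
- split.
  + by move=> y _; case: (fg y).
  + exact/cvg_at_right_filter/cf.
  + exact/cvg_at_left_filter/cf.
- by move=> y _; rewrite derive1E; exact: derive_val.
Qed.

Lemma continuous_bounded01 phi : continuous phi ->
  exists B, forall x, 0 <= x <= 1 -> `|phi x| <= B.
Proof.
move=> cphi.
have [|c _ cmax] := @EVT_max R (fun x => `|phi x|) 0 1 ler01.
  apply: continuous_subspaceT => x.
  by apply: continuous_comp; [exact: cphi|exact: norm_continuous].
by exists `|phi c| => x Ix; apply: cmax; rewrite in_itv.
Qed.

(** [M] bounds the square of the operator norm, which avoids square roots. *)
Definition bounded_op T := exists M, 0 <= M /\
  forall f, rL2 f -> rL2 (T f) /\ ip (T f) (T f) <= M * ip f f.

Lemma bounded_op_id : bounded_op id.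
Proof. by exists 1; split => // f f2; split => //; rewrite mul1r. Qed.

Lemma bounded_op_comp S T : bounded_op S -> bounded_op T ->
  bounded_op (fun f => S (T f)).
Proof.
move=> [M [M0 SM]] [N [N0 TN]]; exists (M * N); split; first exact: mulr_ge0.
move=> f f2; have [Tf2 TfN] := TN _ f2; have [STf2 STfM] := SM _ Tf2.
by split => //; rewrite (le_trans STfM)// -mulrA ler_wpM2l.
Qed.

Lemma bounded_op_add S T a : bounded_op S -> bounded_op T ->
  bounded_op (fun f x => S f x + a * T f x).
Proof.
move=> [M [M0 SM]] [N [N0 TN]]; exists (2 * M + 2 * a ^+ 2 * N); split.
  by have := sqr_ge0 a; nra.
move=> f f2; have [Tf2 TfN] := TN _ f2; have [Sf2 SfM] := SM _ f2.
split; first exact: rL2D.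
(* Nonnegativity of ||S f - a T f||^2 bounds the cross term. *)
have := ip_ge0 (fun x => S f x + (- a) * T f x).
rewrite !(ipDl, ipDr)//; try exact: rL2D.
rewrite (ipC (T f) (S f)); have := sqr_ge0 a.
have : 0 <= a ^+ 2 * (N * ip f f - ip (T f) (T f)) by rewrite mulr_ge0 ?sqr_ge0// subr_ge0.
by move=> *; nra.
Qed.

(** By [sqr_V_le] the square of [V f] is at most the constant [ip f f] pointwise; integrate over an
    interval of length 1. *)
Lemma bounded_op_V : bounded_op V.
Proof.
exists 1; split => // f f2; split; first exact: rL2_V.
have n2 : rL2 (cst (ip f f) : R -> R) by exact: rL2_cst.
have n1 : rL2 (cst 1 : R -> R) by exact: rL2_cst.
apply: (@le_trans _ _ (ip (cst (ip f f)) (cst 1))).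
  apply: le_ip => //; [exact: rL2_V|exact: rL2_V|] => x Ix /=.
  by rewrite mulr1 -expr2; exact: sqr_V_le.
by rewrite ipC ip1 V_cst// mulr1 mul1r.
Qed.

Lemma bounded_op_mul phi : continuous phi -> bounded_op (fun f x => phi x * f x).
Proof.
move=> cphi; have [B phiB] := continuous_bounded01 cphi.
have mphi : measurable_fun (I : set (measurableTypeR R)) phi.
  by have [] := rL2_continuousT cphi.
exists (B ^+ 2); split; first exact: sqr_ge0.
move=> f f2; have pf2 : rL2 (fun x => phi x * f x) by exact: rL2M phiB f2.
split => //.
have c2 : rL2 (cst (B ^+ 2) : R -> R) by exact: rL2_cst.
have -> : B ^+ 2 * ip f f = ip (fun x => 0 + B ^+ 2 * f x) f.
  rewrite (@ipDl _ (cst 0))//; last exact: rL2_cst.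
  rewrite [ip (cst 0) f](_ : _ = 0) ?add0r//.
  rewrite ipE (@eq_Rintegral _ _ _ _ _ (cst 0)) ?Rintegral_cst ?mul0r//.
  by move=> x _; rewrite mul0r.
apply: le_ip => //; first exact: (@rL2D _ (cst 0) f (B ^+ 2) (rL2_cst _) f2).
move=> x Ix; rewrite add0r -[leRHS]mulrA mulrACA -!expr2 ler_wpM2r ?sqr_ge0//.
have := phiB x Ix; rewrite ler_norml => /andP[? ?]; nra.
Qed.

Lemma rL2_op T f : bounded_op T -> rL2 f -> rL2 (T f).
Proof. by move=> [M [_ TM]] /TM[]. Qed.

(** This is [V_byparts] with [V psi] = phi - phi(0); the two terms carrying [phi 0] cancel. *)
Lemma V_smooth_byparts phi psi f x :
  (forall y, is_derive y (1:R) phi (psi y)) -> continuous psi ->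
  rL2 f -> 0 <= x <= 1 ->
  V (fun t => psi t * V f t) x = phi x * V f x - V (fun t => phi t * f t) x.
Proof.
move=> dphi cpsi f2 Ix.
have cphi : continuous phi.
  by move=> y; apply/differentiable_continuous/derivable1_diffP; case: (dphi y).
have := V_byparts Ix (rL2_continuousT cpsi) f2.
have -> : V (fun t => f t * V psi t) x =
    V (fun t => phi t * f t + (- phi 0) * f t) x.
  by apply: eq_V => // t It; rewrite (V_FTC dphi)//; ring.
rewrite VD//; last exact: rL2_op (bounded_op_mul cphi) f2.
rewrite (V_FTC dphi)// => E.
by apply: (addIr (V (fun t => phi t * f t) x + - phi 0 * V f x)); rewrite E; ring.
Qed.

End BoundedOperators.

(** * Homogeneity of [V] and [ip] *)

Section Scaling.
Context {R : realType}.
Implicit Types (f g h phi psi : R -> R) (x y a b : R).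

Lemma rL2Z f a : rL2 f -> rL2 (fun x => a * f x).
Proof.
move=> f2; apply: rL2_eq (rL2D a (rL2_cst 0) f2) => x _ /=.
by rewrite add0r.
Qed.

Lemma VZ f a x : 0 <= x <= 1 -> rL2 f -> V (fun x => a * f x) x = a * V f x.
Proof. by move=> Ix f2; rewrite !VE -RintegralZl//; exact: rL2_integrable0. Qed.

Lemma ipZl f g a : rL2 f -> rL2 g -> ip (fun x => a * f x) g = a * ip f g.
Proof.
move=> f2 g2; rewrite !ipE -RintegralZl//; last exact: rL2_integrableM.
by apply: eq_Rintegral => x _; rewrite mulrA.
Qed.

End Scaling.

(** * Inversion of 1 - c V^2 *)

Section Resolvent.
Context {R : realType}.
Implicit Types (f g h phi psi : R -> R) (x y a b : R).
Variables (C S : R -> R) (c : R).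
Hypothesis dC : forall y, is_derive y (1:R) C (c * S y).
Hypothesis dS : forall y, is_derive y (1:R) S (C y).
Hypothesis CS1 : forall y, C y * C y - c * (S y * S y) = 1.

(* [C] and [S] solve [y'' = c y] with [S' = C], so that [resolvent] is the
   variation-of-constants inverse of [1 - c V^2]. *)
Definition resolvent f x : R :=
  f x + c * (S x * V (fun t => C t * f t) x
             + - 1 * (C x * V (fun t => S t * f t) x)).

Let cC : continuous C.
Proof. by move=> y; apply/differentiable_continuous/derivable1_diffP; case: (dC y). Qed.

Let cS : continuous S.
Proof. by move=> y; apply/differentiable_continuous/derivable1_diffP; case: (dS y). Qed.

Lemma bounded_op_resolvent : bounded_op resolvent.
Proof.
apply: (@bounded_op_add R id _ c); first exact: bounded_op_id.
apply: (@bounded_op_add R _ _ (-1)).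
- apply: bounded_op_comp (bounded_op_mul cS) _.
  exact: bounded_op_comp bounded_op_V (bounded_op_mul cC).
- apply: bounded_op_comp (bounded_op_mul cC) _.
  exact: bounded_op_comp bounded_op_V (bounded_op_mul cS).
Qed.

(** Write the resolvent as f + c k. One integration by parts computes c V k, a second one gives c
    V^2 k = k - V^2 f, so V^2 of the resolvent is k. *)
Lemma resolventK f x : rL2 f -> 0 <= x <= 1 ->
  resolvent f x - c * V (V (resolvent f)) x = f x.
Proof.
move=> f2 Ix.
have mC g : rL2 g -> rL2 (fun x => C x * g x).
  by move=> g2; exact: rL2_op (bounded_op_mul cC) g2.
have mS g : rL2 g -> rL2 (fun x => S x * g x).
  by move=> g2; exact: rL2_op (bounded_op_mul cS) g2.
have ccS : continuous (fun x => c * S x).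
  by move=> y; apply: continuousM; [exact: cst_continuous|exact: cS].
pose a := V (fun t => C t * f t); pose b := V (fun t => S t * f t).
pose k x := S x * a x + - 1 * (C x * b x).
have a2 : rL2 a by apply: rL2_V; exact: mC.
have b2 : rL2 b by apply: rL2_V; exact: mS.
have k2 : rL2 k by apply: rL2D; [exact: mS|exact: mC].
have cSE g y : 0 <= y <= 1 -> rL2 g ->
    V (fun t => c * S t * g t) y = c * V (fun t => S t * g t) y.
  move=> Iy g2; rewrite -VZ//; last exact: mS.
  by apply: eq_V => // t _; rewrite mulrA.
have Vk y : 0 <= y <= 1 -> c * V k y = C y * a y + - c * (S y * b y) + - 1 * V f y.
  move=> Iy; rewrite VD//; [|exact: mS|exact: mC].
  have := V_smooth_byparts dC ccS (mC _ f2) Iy; rewrite -/a cSE// => E1.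
  have := V_smooth_byparts dS cC (mS _ f2) Iy; rewrite -/b => E2.
  (* Inserting C^2 - c S^2 = 1 in front of f matches the two integrals left over by the integrations
     by parts. *)
  have : V f y = V (fun t => C t * (C t * f t) + - c * (S t * (S t * f t))) y.
    apply: eq_V => // t _; rewrite -[LHS]mul1r -(CS1 t); ring.
  rewrite VD//; [|exact: (mC _ (mC _ f2))|exact: (mS _ (mS _ f2))] => E3.
  rewrite mulrDr E1 E2 E3; ring.
have VVk : c * V (V k) x = k x - V (V f) x.
  rewrite -VZ//; last exact: rL2_V.
  rewrite (eq_V Ix Vk) VD//; last 2 first.
  - by apply: rL2D; [exact: mC|exact: mS].
  - exact: rL2_V.
  rewrite VD//; [|exact: mC|exact: mS].
  have := V_smooth_byparts dS cC (mC _ f2) Ix; rewrite -/a => ->.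
  have := V_smooth_byparts dC ccS (mS _ f2) Ix; rewrite -/b cSE// mulNr => ->.
  have -> : V (fun t => C t * (S t * f t)) x = V (fun t => S t * (C t * f t)) x.
    by apply: eq_V => // t _; ring.
  rewrite /k; ring.
have -> : V (V (resolvent f)) x = V (V f) x + c * V (V k) x.
  rewrite -VD//; [|exact: rL2_V|exact: rL2_V].
  by apply: eq_V => // t It; rewrite -VD.
rewrite VVk /resolvent -/a -/b /k.
generalize (V (V f) x), (a x), (b x) => ? ? ?; ring.
Qed.

End Resolvent.

(** * The form q of (tau^2 + delta) I - T^* T and its boundary terms *)

Section Form.
Context {R : realType}.
Variables (sigma tau : R).
Implicit Types (f g h : R -> R) (x a delta : R).

Local Notation s := (sigma ^+ 2 - 2 * tau).

Definition pVr f x : R := V (V f) x + sigma * V f x + tau * f x.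

Lemma bounded_op_pVr : bounded_op pVr.
Proof.
apply: (@bounded_op_add R (fun f x => V (V f) x + sigma * V f x) id tau).
  apply: bounded_op_add bounded_op_V.
  exact: bounded_op_comp bounded_op_V bounded_op_V.
exact: bounded_op_id.
Qed.

Lemma pVrD f g a x : rL2 f -> rL2 g -> 0 <= x <= 1 ->
  pVr (fun x => f x + a * g x) x = pVr f x + a * pVr g x.
Proof.
move=> f2 g2 Ix; rewrite /pVr.
rewrite (eq_V Ix (fun y Iy => VD a Iy f2 g2)) !VD//; try exact: rL2_V.
ring.
Qed.

Definition qform delta f g : R :=
  (tau ^+ 2 + delta) * ip f g - ip (pVr f) (pVr g).

Lemma qformC delta f g : qform delta f g = qform delta g f.
Proof. by rewrite /qform ipC (ipC (pVr f)). Qed.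

Lemma qformDl delta f g h a : rL2 f -> rL2 g -> rL2 h ->
  qform delta (fun x => f x + a * g x) h = qform delta f h + a * qform delta g h.
Proof.
move=> f2 g2 h2; rewrite /qform ipDl//.
have T2 k : rL2 k -> rL2 (pVr k) by exact: rL2_op bounded_op_pVr.
have -> : ip (pVr (fun x => f x + a * g x)) (pVr h) =
    ip (fun x => pVr f x + a * pVr g x) (pVr h).
  by apply: eq_ip => // x Ix; exact: pVrD.
rewrite ipDl; [ring|exact: T2..].
Qed.

Lemma qformZl delta f g a : rL2 f -> rL2 g ->
  qform delta (fun x => a * f x) g = a * qform delta f g.
Proof.
move=> f2 g2; have z2 : rL2 (cst 0 : R -> R) by exact: rL2_cst.
have qE b : qform delta (fun x => cst 0 x + b * f x) g =
    qform delta (fun x => b * f x) g.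
  by congr (qform _ _ _); apply/funext => x /=; rewrite add0r.
have qf0 : qform delta (cst 0) g = 0.
  have := qE 1; rewrite qformDl// mul1r => /(canRL (addrK _)) ->.
  rewrite (_ : (fun x => 1 * f x) = f) ?subrr//.
  by apply/funext => x; rewrite mul1r.
by rewrite -qE qformDl// qf0 add0r.
Qed.

(* The boundary terms at 1 in the integrations by parts that move both [V]s of
   [V (V g)] from [g] to [h] in [qform]. *)
Definition bc0 h : R := V (V (V h)) 1 + sigma * V (V h) 1 + tau * V h 1.
Definition bc1 h : R :=
  - V (V (V (V h))) 1 + (s + tau) * V (V h) 1 + sigma * tau * V h 1.

(** Each [ip_byparts] moves one [V] from [g] to [h] at the cost of a product of values at 1. The
    bulk terms assemble into the pairing of D h with [g]; [r] is free so that D h can be supplied in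
    closed form. *)
Lemma qformE delta r h g : rL2 h -> rL2 g ->
  (forall x, 0 <= x <= 1 ->
    delta * h x + s * V (V h) x + - 1 * V (V (V (V h))) x = r x) ->
  qform delta h g = ip r g - bc0 h * V (V g) 1 - bc1 h * V g 1.
Proof.
move=> h2 g2 Dh.
have V2 (k : R -> R) : rL2 k -> rL2 (V k) by exact: rL2_V.
have h12 := V2 _ h2; have h22 := V2 _ h12; have h32 := V2 _ h22.
have h42 := V2 _ h32; have g12 := V2 _ g2; have g22 := V2 _ g12.
rewrite -(@eq_ip _ _ _ g g Dh (fun _ _ => erefl)).
have dh2 := rL2Z delta h2; have sh2 := rL2D s dh2 h22.
have T2 (k : R -> R) : rL2 k -> rL2 (fun x => V (V k) x + sigma * V k x).
  by move=> k2; apply: rL2D; [exact: (V2 _ (V2 _ k2))|exact: V2].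
rewrite (ipDl (-1) sh2 h42 g2) (ipDl s dh2 h22 g2) (ipZl delta h2 g2).
have P0 := ip_byparts h2 g2; have P1 := ip_byparts h2 g12.
have P2 := ip_byparts h12 g2; have P3 := ip_byparts h12 g12.
have P4 := ip_byparts h22 g12; have P5 := ip_byparts h32 g2.
rewrite /qform /pVr.
have T2' (k : R -> R) : rL2 k -> rL2 (fun x => V (V k) x + sigma * V k x + tau * k x).
  by move=> k2; apply: rL2D => //; exact: T2.
rewrite (ipDl tau (T2 _ h2) h2 (T2' _ g2)) (ipDl sigma h22 h12 (T2' _ g2)).
have Eg k (k2 : rL2 k) : ip k (fun x => V (V g) x + sigma * V g x + tau * g x) =
    ip k (V (V g)) + sigma * ip k (V g) + tau * ip k g.
  by rewrite (ipDr tau (T2 _ g2) g2 k2) (ipDr sigma g22 g12 k2).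
rewrite (Eg _ h22) (Eg _ h12) (Eg _ h2).
rewrite /bc0 /bc1.
move: P0 P1 P2 P3 P4 P5; clear.
generalize (ip h g), (ip h (V g)), (ip h (V (V g))), (ip (V h) g), (ip (V h) (V g)),
  (ip (V h) (V (V g))), (ip (V (V h)) g), (ip (V (V h)) (V g)), (ip (V (V h)) (V (V g))),
  (ip (V (V (V h))) (V g)), (ip (V (V (V (V h)))) g), (V (V (V (V h))) 1),
  (V (V (V h)) 1), (V (V h) 1), (V h 1), (V (V g) 1), (V g 1).
move=> ? ? ? ? ? ? ? ? ? ? ? ? ? ? ? ? ?.
(* Each relation is solved for the inner product with one more [V] on [g]; what remains is a
   polynomial identity. *)
do 6 move/(canRL (addrK _)) => ->.
ring.
Qed.

End Form.

(** * Hyperbolic and trigonometric functions under differentiation and [V] *)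

Section HyperbolicTrigonometric.
Context {R : realType}.
Implicit Types (x y a b w : R).

Lemma is_derive_lin (F G : R -> R) (F' G' a b y : R) :
  is_derive y (1:R) F F' -> is_derive y (1:R) G G' ->
  is_derive y (1:R) (fun x => a * F x + b * G x) (a * F' + b * G').
Proof.
move=> dF dG.
have := is_deriveD (is_deriveZ a dF) (is_deriveZ b dG).
by apply.
Qed.

Lemma is_derive_scale (F : R -> R) (F' w y : R) :
  is_derive (w * y) (1:R) F F' -> is_derive y (1:R) (fun x => F (w * x)) (w * F').
Proof.
move=> dF.
have dw : is_derive y (1:R) (fun x => w * x) w.
  by apply: is_derive_eq; rewrite /= -[RHS]mulr1.
have := @is_derive1_comp R F (fun x => w * x) y F' w dF dw.
by rewrite mulrC.
Qed.

Lemma is_derive_cosh y : is_derive y (1:R) (@cosh R) (sinh y).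
Proof.
have dN : is_derive y (1:R) (fun x => expR (-1 * x)) (-1 * expR (-1 * y)).
  exact: is_derive_scale.
have := is_derive_lin 2^-1 2^-1 (is_derive_expR y) dN.
have -> : (fun x => 2^-1 * expR x + 2^-1 * expR (-1 * x)) = @cosh R.
  by apply/funext => x; rewrite /cosh !mulN1r; ring.
move=> d; apply: (is_derive_eq d); rewrite /sinh !mulN1r; ring.
Qed.

Lemma is_derive_sinh y : is_derive y (1:R) (@sinh R) (cosh y).
Proof.
have dN : is_derive y (1:R) (fun x => expR (-1 * x)) (-1 * expR (-1 * y)).
  exact: is_derive_scale.
have := is_derive_lin 2^-1 (- 2^-1) (is_derive_expR y) dN.
have -> : (fun x => 2^-1 * expR x + - 2^-1 * expR (-1 * x)) = @sinh R.
  by apply/funext => x; rewrite /sinh !mulN1r; ring.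
move=> d; apply: (is_derive_eq d); rewrite /cosh !mulN1r; ring.
Qed.

Lemma cosh2_sinh2 x : cosh x * cosh x - sinh x * sinh x = 1.
Proof.
have : expR x * expR (- x) = 1 :> R by rewrite -expRD subrr expR0.
rewrite /cosh /sinh => e; by rewrite -[RHS]e; field.
Qed.

Lemma cosh0 : cosh 0 = 1 :> R.
Proof. by rewrite /cosh oppr0 expR0; field. Qed.

Lemma sinh0 : sinh 0 = 0 :> R.
Proof. by rewrite /sinh oppr0 expR0; field. Qed.

Variables (w1 w2 : R).

(** Differentiation exchanges the two families [evenE] and [oddE], and so does [V] up to an additive
    constant, so iterated integrals become bookkeeping of two coefficients. *)
Definition evenE a b x : R := a * cosh (w1 * x) + b * cos (w2 * x).
Definition oddE a b x : R := a * sinh (w1 * x) + b * sin (w2 * x).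

Lemma is_derive_evenE a b y :
  is_derive y (1:R) (evenE a b) (oddE (a * w1) (- b * w2) y).
Proof.
have := is_derive_lin a b (is_derive_scale (is_derive_cosh (w1 * y)))
  (is_derive_scale (is_derive_cos (w2 * y))).
move=> d; apply: (is_derive_eq d); rewrite /oddE; ring.
Qed.

Lemma is_derive_oddE a b y :
  is_derive y (1:R) (oddE a b) (evenE (a * w1) (b * w2) y).
Proof.
have := is_derive_lin a b (is_derive_scale (is_derive_sinh (w1 * y)))
  (is_derive_scale (is_derive_sin (w2 * y))).
move=> d; apply: (is_derive_eq d); rewrite /evenE; ring.
Qed.

Lemma continuous_evenE a b : continuous (evenE a b).
Proof.
move=> y; apply/differentiable_continuous/derivable1_diffP.
by case: (is_derive_evenE a b y).
Qed.

Lemma continuous_oddE a b : continuous (oddE a b).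
Proof.
move=> y; apply/differentiable_continuous/derivable1_diffP.
by case: (is_derive_oddE a b y).
Qed.

(** The new coefficients are given by equations instead of quotients by [w1] and [w2], so no
    division occurs. *)
Lemma V_evenE a b a' b' x : a' * w1 = a -> b' * w2 = b -> 0 <= x <= 1 ->
  V (evenE a b) x = oddE a' b' x.
Proof.
move=> <- <- Ix; rewrite (V_FTC (is_derive_oddE a' b') (@continuous_evenE _ _))//.
by rewrite [X in _ - X]/oddE !mulr0 sinh0 sin0 !mulr0 addr0 subr0.
Qed.

Lemma V_oddE a b a' b' x : a' * w1 = a -> - b' * w2 = b -> 0 <= x <= 1 ->
  V (oddE a b) x = evenE a' b' x - (a' + b').
Proof.
move=> <- <- Ix; rewrite (V_FTC (is_derive_evenE a' b') (@continuous_oddE _ _))//.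
by rewrite [X in _ - X]/evenE !mulr0 cosh0 cos0 !mulr1.
Qed.

End HyperbolicTrigonometric.

(** * The extremal functions and the 2 x 2 matrix of q *)

Section Extremals.
Context {R : realType}.
Variables (sigma tau delta w1 w2 : R).
Local Notation s := (sigma ^+ 2 - 2 * tau).
Hypothesis sumE : s = delta * (w2 ^+ 2 - w1 ^+ 2).
Hypothesis prodE : delta * w1 ^+ 2 * w2 ^+ 2 = 1.
Implicit Types (f g h : R -> R) (x y a b : R).

Local Notation O0 := (Omega0 w1 w2).
Local Notation O1 := (Omega1 w1 w2).
Local Notation O2 := (Omega2 w1 w2).
Local Notation O3 := (Omega3 w1 w2).
Local Notation even := (evenE w1 w2).
Local Notation odd := (oddE w1 w2).
Local Notation qform := (qform sigma tau delta).

(* [ext0] and [ext1] are the second derivatives of [cosh w1 x - cos w2 x] and of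
   [sinh w1 x / w1 - sin w2 x / w2]. *)
Definition ext0 : R -> R := evenE w1 w2 (w1 ^+ 2) (w2 ^+ 2).
Definition ext1 : R -> R := oddE w1 w2 w1 w2.

(** The constant value of D [ext0], and the slope of D [ext1]. *)
Let kappa := delta * (w1 ^+ 2 + w2 ^+ 2).

Lemma rL2_ext0 : rL2 ext0.
Proof. exact/rL2_continuousT/continuous_evenE. Qed.

Lemma rL2_ext1 : rL2 ext1.
Proof. exact/rL2_continuousT/continuous_oddE. Qed.

Let Ve0 x : 0 <= x <= 1 -> V ext0 x = ext1 x.
Proof. by move=> Ix; apply: V_evenE => //; rewrite expr2. Qed.

Let Ve1 x : 0 <= x <= 1 -> V ext1 x = even 1 (-1) x.
Proof.
move=> Ix; rewrite (@V_oddE _ w1 w2 _ _ 1 (-1)) ?mul1r ?opprK ?mul1r//.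
by rewrite subrr subr0.
Qed.

(** By [prodE], 1 / w1 is delta w1 w2^2 and 1 / w2 is delta w2 w1^2, which keeps the coefficients
    polynomial. *)
Let VVe1 x : 0 <= x <= 1 ->
  V (V ext1) x = odd (delta * w1 * w2 ^+ 2) (- (delta * w2 * w1 ^+ 2)) x.
Proof.
move=> Ix; rewrite (eq_V Ix Ve1); apply: V_evenE => //.
  by rewrite -prodE; ring.
by rewrite -[in RHS]prodE; ring.
Qed.

Let VVVe1 x : 0 <= x <= 1 ->
  V (V (V ext1)) x = even (delta * w2 ^+ 2) (delta * w1 ^+ 2) x - kappa.
Proof.
move=> Ix; rewrite (eq_V Ix VVe1).
rewrite (@V_oddE _ w1 w2 _ _ (delta * w2 ^+ 2) (delta * w1 ^+ 2))//; try ring.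
by congr (_ - _); rewrite /kappa; ring.
Qed.

Let VVVVe1 x : 0 <= x <= 1 -> V (V (V (V ext1))) x =
  odd (delta ^+ 2 * w1 * w2 ^+ 4) (delta ^+ 2 * w2 * w1 ^+ 4) x - kappa * x.
Proof.
move=> Ix; have /andP[x0 _] := Ix; rewrite (eq_V Ix VVVe1).
have -> : V (fun x => even (delta * w2 ^+ 2) (delta * w1 ^+ 2) x - kappa) x =
   V (fun x => even (delta * w2 ^+ 2) (delta * w1 ^+ 2) x + (-1) * cst kappa x) x.
  by apply: eq_V => // y _; rewrite mulN1r.
rewrite VD//; [|exact/rL2_continuousT/continuous_evenE|exact: rL2_cst].
rewrite V_cst// mulN1r; congr (_ - _); apply: V_evenE => //.
  by rewrite -[RHS]mulr1 -prodE; ring.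
by rewrite -[RHS]mulr1 -prodE; ring.
Qed.

Let VVe0 x : 0 <= x <= 1 -> V (V ext0) x = V ext1 x.
Proof. by move=> Ix; apply: eq_V => // y; exact: Ve0. Qed.

Let VVVe0 x : 0 <= x <= 1 -> V (V (V ext0)) x = V (V ext1) x.
Proof. by move=> Ix; apply: eq_V => // y; exact: VVe0. Qed.

Let VVVVe0 x : 0 <= x <= 1 -> V (V (V (V ext0))) x = V (V (V ext1)) x.
Proof. by move=> Ix; apply: eq_V => // y; exact: VVVe0. Qed.

(** If u(0) = u'(0) = 0, then D u'' = delta u'' + s u - V^2 u, whose second derivative delta u'''' +
    s u'' - u vanishes. Hence D u'' is affine; the proof checks this on explicit iterates. *)
Lemma ext0_ode x : 0 <= x <= 1 ->
  delta * ext0 x + s * V (V ext0) x + -1 * V (V (V (V ext0))) x = kappa.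
Proof.
move=> Ix; rewrite VVe0// VVVVe0// VVVe1// Ve1// sumE /ext0 /evenE; ring.
Qed.

Lemma ext1_ode x : 0 <= x <= 1 ->
  delta * ext1 x + s * V (V ext1) x + -1 * V (V (V (V ext1))) x = kappa * x.
Proof.
move=> Ix; rewrite VVVVe1// VVe1// sumE /ext1 /oddE.
(* The factor delta w1^2 w2^2, equal to 1 by [prodE], is inserted into delta w1 to make both sides
   homogeneous in delta. *)
have -> : delta ^+ 2 * w1 * w2 ^+ 4 =
    delta * w1 + delta * (w2 ^+ 2 - w1 ^+ 2) * (delta * w1 * w2 ^+ 2).
  transitivity (delta * w1 * (delta * w1 ^+ 2 * w2 ^+ 2) +
    delta * (w2 ^+ 2 - w1 ^+ 2) * (delta * w1 * w2 ^+ 2)); last by rewrite prodE mulr1.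
  by ring.
have -> : delta ^+ 2 * w2 * w1 ^+ 4 =
    delta * w2 - delta * (w2 ^+ 2 - w1 ^+ 2) * (delta * w2 * w1 ^+ 2).
  transitivity (delta * w2 * (delta * w1 ^+ 2 * w2 ^+ 2) -
    delta * (w2 ^+ 2 - w1 ^+ 2) * (delta * w2 * w1 ^+ 2)); last by rewrite prodE mulr1.
  by ring.
by ring.
Qed.

(** The four entries are the negatives of the four brackets of [char_fun]. Rows belong to [ext0] and
    [ext1], columns to the functionals [V g 1] and, with a minus sign, [V (V g) 1]. *)
Definition m00 : R := delta * O2 - tau * O0 - sigma * tau * O1.
Definition m01 : R := sigma * O0 - (tau - sigma ^+ 2) * O1 + delta * O3.
Definition m10 : R :=
  - (sigma * tau * O0 + (sigma ^+ 2 * tau - 2 * tau ^+ 2 - delta) * O1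
      + tau * delta * O3).
Definition m11 : R :=
  - ((tau - sigma ^+ 2) * O0 - sigma * s * O1 - delta * O2 - sigma * delta * O3).

Let I1 : 0 <= (1 : R) <= 1. Proof. by rewrite ler01 lexx. Qed.

Let V1 : V ext0 1 = O1.
Proof. by rewrite Ve0// /ext1 /oddE !mulr1. Qed.

Let V2 : V ext1 1 = O0.
Proof. by rewrite Ve1// /evenE !mulr1 mul1r mulN1r. Qed.

Let V3 : V (V ext1) 1 = delta * O3 + s * O1.
Proof. by rewrite VVe1// sumE /oddE !mulr1 /Omega3 /Omega1; ring. Qed.

Let V4 : V (V (V ext1)) 1 = delta * O2 + s * O0 - kappa.
Proof. by rewrite VVVe1// sumE /evenE !mulr1 /Omega2 /Omega0; ring. Qed.

Let V5 : V (V (V (V ext1))) 1 = delta * O1 + s * (delta * O3 + s * O1) - kappa.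
Proof.
(* The fourth iterate is read off the equation at x = 1 instead of being expanded. *)
have := ext1_ode I1; rewrite mulr1 => <-.
by rewrite V3 /ext1 /oddE !mulr1 /Omega1; ring.
Qed.

Let ip_cst c g : rL2 g -> ip (cst c) g = c * V g 1.
Proof.
move=> g2; rewrite -ip1 -ipZl//; last exact: rL2_cst.
by apply: eq_ip => // x _ /=; rewrite mulr1.
Qed.

(** The identity function is [V] of the constant 1, so [ip_byparts] applies. *)
Let ip_id c g : rL2 g -> ip (fun x => c * x) g = c * (V g 1 - V (V g) 1).
Proof.
move=> g2.
have c2 : rL2 (cst 1 : R -> R) by exact: rL2_cst.
have -> : ip (fun x => c * x) g = ip (fun x => c * V (cst 1) x) g.
  by apply: eq_ip => // x /andP[x0 _]; rewrite V_cst// mul1r.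
rewrite ipZl//; last exact: rL2_V.
have := ip_byparts c2 g2; rewrite V_cst// mulr1 mul1r ip1 => <-.
by rewrite [X in _ * (X - _)]addrC addrK.
Qed.

(** D [ext0] is constant, so its pairing with [g] sees only [V g 1]; the boundary terms of [qformE]
    add only [V (V g) 1]. *)
Lemma qform_ext0 g : rL2 g -> qform ext0 g = m00 * V g 1 - m01 * V (V g) 1.
Proof.
move=> g2; rewrite (qformE rL2_ext0 g2 ext0_ode) (ip_cst _ g2).
rewrite /bc0 /bc1 VVVVe0// VVVe0// VVe0// V1 V2 V3 V4 /m00 /m01.
by generalize (V g 1), (V (V g) 1) => ? ?; ring.
Qed.

Lemma qform_ext1 g : rL2 g -> qform ext1 g = m10 * V g 1 - m11 * V (V g) 1.
Proof.
move=> g2; rewrite (qformE rL2_ext1 g2 ext1_ode) (ip_id _ g2).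
rewrite /bc0 /bc1 V5 V4 V3 V2 /m10 /m11.
by generalize (V g 1), (V (V g) 1) => ? ?; ring.
Qed.

End Extremals.

(** * Bounded functionals and rank-one operators *)

Section BoundedFunctionals.
Context {R : realType}.
Implicit Types (f g h : R -> R) (T : (R -> R) -> R -> R) (l : (R -> R) -> R).

Definition bounded_functional l := exists M, 0 <= M /\
  forall f, rL2 f -> l f ^+ 2 <= M * ip f f.

Lemma bounded_functional_V1 T : bounded_op T ->
  bounded_functional (fun f => V (T f) 1).
Proof.
move=> [M [M0 TM]]; exists M; split => // f f2; have [Tf2 TfM] := TM _ f2.
by apply: le_trans TfM; apply: sqr_V_le => //; rewrite ler01 lexx.
Qed.

Lemma bounded_functional_add l l' (a b : R) :
  bounded_functional l -> bounded_functional l' ->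
  bounded_functional (fun f => a * l f + b * l' f).
Proof.
move=> [M [M0 lM]] [N [N0 lN]].
exists (2 * a ^+ 2 * M + 2 * b ^+ 2 * N); split.
  by have := sqr_ge0 a; have := sqr_ge0 b; nra.
move=> f f2; have := lM _ f2; have := lN _ f2.
move: (l f) (l' f) (ip f f) => u v i vN uM.
have : 0 <= a ^+ 2 * (M * i - u ^+ 2) by rewrite mulr_ge0 ?sqr_ge0// subr_ge0.
have : 0 <= b ^+ 2 * (N * i - v ^+ 2) by rewrite mulr_ge0 ?sqr_ge0// subr_ge0.
have := sqr_ge0 (a * u - b * v).
by clear; nra.
Qed.

Lemma bounded_op_rank1 l g : bounded_functional l -> rL2 g ->
  bounded_op (fun f x => l f * g x).
Proof.
move=> [M [M0 lM]] g2; exists (M * ip g g); split.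
  by rewrite mulr_ge0// ip_ge0.
move=> f f2; split; first exact: rL2Z.
rewrite ipZl//; last exact: rL2Z.
rewrite ipC ipZl// mulrA -expr2 [leRHS]mulrAC ler_wpM2r ?ip_ge0//.
exact: lM.
Qed.

End BoundedFunctionals.

(** * Null vectors of q when the determinant vanishes, and coercivity when it does not *)

Section Eigenvalues.
Context {R : realType}.
Variables (sigma tau delta w1 w2 : R).
Local Notation s := (sigma ^+ 2 - 2 * tau).
Hypothesis delta_gt0 : 0 < delta.
Hypothesis w1_gt0 : 0 < w1.
Hypothesis w2_gt0 : 0 < w2.
Hypothesis sumE : s = delta * (w2 ^+ 2 - w1 ^+ 2).
Hypothesis prodE : delta * w1 ^+ 2 * w2 ^+ 2 = 1.
Implicit Types (f g h : R -> R) (x y a b : R).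

Local Notation e0 := (ext0 w1 w2).
Local Notation e1 := (ext1 w1 w2).
Local Notation qform := (qform sigma tau delta).
Local Notation m00 := (m00 sigma tau delta w1 w2).
Local Notation m01 := (m01 sigma tau delta w1 w2).
Local Notation m10 := (m10 sigma tau delta w1 w2).
Local Notation m11 := (m11 sigma tau delta w1 w2).
Local Notation det := (m00 * m11 - m10 * m01).

Let e02 : rL2 e0. Proof. exact: rL2_ext0. Qed.
Let e12 : rL2 e1. Proof. exact: rL2_ext1. Qed.

(** If the norm vanished, [sqr_V_le] would make [V h] and all further iterates zero on [0, 1], and
    the two equations would force a = b = 0. The leading [0 +] puts both multiples into the shape of
    [rL2D]. *)
Lemma ip_extremal_gt0 a b : (a != 0) || (b != 0) ->
  0 < ip (fun x => 0 + a * e0 x + b * e1 x) (fun x => 0 + a * e0 x + b * e1 x).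
Proof.
move=> ab0; set h := fun x => _.
have z2 : rL2 (cst 0 : R -> R) by exact: rL2_cst.
have ae2 : rL2 (fun x => 0 + a * e0 x) by exact: rL2D z2 e02.
have h2 : rL2 h by exact: rL2D.
rewrite lt0r ip_ge0 andbT; apply: contraTneq ab0 => h0.
have Vh x : 0 <= x <= 1 -> V h x = cst 0 x.
  by move=> Ix; apply/eqP; rewrite -sqrf_eq0 eq_le sqr_ge0 andbT -h0 sqr_V_le.
have V0 x : 0 <= x <= 1 -> V (cst 0) x = cst 0 x.
  by move=> /andP[x0 _]; rewrite V_cst ?mul0r.
have VVh x : 0 <= x <= 1 -> V (V h) x = cst 0 x.
  by move=> Ix; rewrite (eq_V Ix Vh) V0.
have VVVh x : 0 <= x <= 1 -> V (V (V h)) x = cst 0 x.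
  by move=> Ix; rewrite (eq_V Ix VVh) V0.
have VVVVh x : 0 <= x <= 1 -> V (V (V (V h))) x = cst 0 x.
  by move=> Ix; rewrite (eq_V Ix VVVh) V0.
pose k := delta * (w1 ^+ 2 + w2 ^+ 2).
have k0 : 0 < k by rewrite mulr_gt0// addr_gt0// exprn_gt0.
have Vlin x : 0 <= x <= 1 -> forall F G,
  (forall y, 0 <= y <= 1 -> F y = 0 + a * G e0 y + b * G e1 y) ->
  rL2 (G e0) -> rL2 (G e1) -> V F x = 0 + a * V (G e0) x + b * V (G e1) x.
  move=> Ix F G FG G0 G1; rewrite (eq_V Ix FG) VD//; last exact: rL2D z2 G0.
  by rewrite (VD _ Ix z2 G0) V0.
have r2 := rL2_V.
have L1 y : 0 <= y <= 1 -> V h y = 0 + a * V e0 y + b * V e1 y.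
  by move=> Iy; apply: (Vlin y Iy h id).
have L2 y : 0 <= y <= 1 -> V (V h) y = 0 + a * V (V e0) y + b * V (V e1) y.
  by move=> Iy; apply: (Vlin y Iy (V h) V) => //; exact: r2.
have L3 y : 0 <= y <= 1 -> V (V (V h)) y = 0 + a * V (V (V e0)) y + b * V (V (V e1)) y.
  by move=> Iy; apply: (Vlin y Iy (V (V h)) (fun g => V (V g))) => //; do 2 apply: rL2_V.
have L4 y : 0 <= y <= 1 -> V (V (V (V h))) y =
    0 + a * V (V (V (V e0))) y + b * V (V (V (V e1))) y.
  move=> Iy; apply: (Vlin y Iy (V (V (V h))) (fun g => V (V (V g)))) => //.
  - by do 3 apply: rL2_V.
  - by do 3 apply: rL2_V.
(* Since V^2 h and V^4 h vanish, D h reduces to delta h, and by the two equations it is k (a + b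
   x). *)
have hE x : 0 <= x <= 1 -> delta * h x = cst (k * a) x + k * b * V (cst 1) x.
  move=> Ix; have /andP[x0 _] := Ix; rewrite V_cst//= mul1r.
  have E0 := ext0_ode sumE prodE Ix; have E1 := ext1_ode sumE prodE Ix.
  have : delta * h x + s * V (V h) x + - 1 * V (V (V (V h))) x =
      a * (delta * e0 x + s * V (V e0) x + -1 * V (V (V (V e0))) x) +
      b * (delta * e1 x + s * V (V e1) x + -1 * V (V (V (V e1))) x).
    rewrite L2// L4// /h.
    generalize (e0 x), (V (V e0) x), (V (V (V (V e0))) x),
      (e1 x), (V (V e1) x), (V (V (V (V e1))) x).
    by move=> *; ring.
  rewrite E0 E1 VVh// VVVVh//= !mulr0 !addr0 => ->.
  by rewrite /k; ring.
have c2 c : rL2 (cst c : R -> R) by exact: rL2_cst.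
(* The relation is integrated once because [V h], unlike [h], is known to vanish at every point. *)
have quad x : 0 <= x <= 1 -> k * (a * x + b * (x * x / 2)) = 0.
  move=> Ix; have /andP[x0 _] := Ix.
  have : V (fun x => delta * h x) x = V (fun x => cst (k * a) x + k * b * V (cst 1) x) x.
    exact: eq_V.
  rewrite VZ// (Vh x Ix : V h x = 0) mulr0 (VD _ Ix (c2 (k * a)) (r2 _ _ (c2 1))).
  rewrite V_cst//.
  have := V_byparts Ix (c2 1) (c2 1); rewrite V_cst// mul1r.
  have -> : V (fun t => cst 1 t * V (cst 1) t) x = V (V (cst 1)) x.
    by apply: eq_V => // t _; rewrite mul1r.
  move: (V (V (cst 1)) x) => u uE zE.
  by rewrite -uE [RHS]zE; field.
(* Evaluation at 1 and at 1/2 gives two independent equations for a and b. *)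
have /eqP := quad 1 (introT andP (conj ler01 (lexx _))).
rewrite mulf_eq0 (gt_eqF k0)/= => /eqP q1.
have /eqP : k * (a * 2^-1 + b * (2^-1 * 2^-1 / 2)) = 0 by apply: quad; lra.
rewrite mulf_eq0 (gt_eqF k0)/= => /eqP q2.
have b0 : b = 0 by lra.
have a0 : a = 0 by lra.
by rewrite a0 b0 eqxx.
Qed.

(** A vector (a, b) in the left kernel of the matrix makes q(h, .) vanish identically for h = a
    [ext0] + b [ext1]. *)
Lemma eigenfunction : det = 0 ->
  exists2 h, rL2 h /\ 0 < ip h h & qform h h = 0.
Proof.
move=> det0.
have [a [b [ab0 ab1 ab2]]] : exists a b, [/\ (a != 0) || (b != 0),
    a * m00 + b * m10 = 0 & a * m01 + b * m11 = 0].
  (* Either column of the matrix, if nonzero, yields a kernel vector by swapping its entries with a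
     sign; if both vanish, any vector works. *)
  have [m0|] := boolP ((m10 != 0) || (- m00 != 0)).
    by exists m10, (- m00); split => //; [ring|rewrite -[RHS]oppr0 -det0; ring].
  rewrite negb_or !negbK [- m00 == 0]oppr_eq0 => /andP[/eqP m10E /eqP m00E].
  have [m0|] := boolP ((m11 != 0) || (- m01 != 0)).
    by exists m11, (- m01); split => //; [rewrite -[RHS]det0; ring|ring].
  rewrite negb_or !negbK [- m01 == 0]oppr_eq0 => /andP[/eqP m11E /eqP m01E].
  by exists 1, 0; rewrite oner_eq0 m00E m01E m10E m11E !mulr0 addr0.
have z2 : rL2 (cst 0 : R -> R) by exact: rL2_cst.
have ae2 : rL2 (fun x => 0 + a * e0 x) by exact: rL2D z2 e02.
exists (fun x => 0 + a * e0 x + b * e1 x).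
  by split; [exact: rL2D|exact: ip_extremal_gt0].
set h := (X in qform X X).
have h2 : rL2 h by exact: rL2D.
rewrite {1}/h qformDl// (@qformDl _ _ _ _ (cst 0))//.
rewrite (qform_ext0 sumE prodE h2) (qform_ext1 sumE prodE h2).
have -> : qform (cst 0) h = 0.
  have -> : cst 0 = (fun x => 0 * e0 x) by apply/funext => x /=; rewrite mul0r.
  by rewrite qformZl// mul0r.
transitivity ((a * m00 + b * m10) * V h 1 - (a * m01 + b * m11) * V (V h) 1).
  by move: (V h 1) (V (V h) 1) => *; ring.
by rewrite ab1 ab2 !mul0r subrr.
Qed.

(** The data of [resolvent] for the two factors of D: c = w1^2 with hyperbolic functions, c = - w2^2
    with trigonometric ones. *)
Let C1 x := cosh (w1 * x).
Let S1 x := w1^-1 * sinh (w1 * x).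
Let C2 x := cos (w2 * x).
Let S2 x := w2^-1 * sin (w2 * x).

Let w1n0 : w1 != 0. Proof. by rewrite gt_eqF. Qed.
Let w2n0 : w2 != 0. Proof. by rewrite gt_eqF. Qed.

Let dC1 y : is_derive y (1:R) C1 (w1 ^+ 2 * S1 y).
Proof.
apply: (is_derive_eq (is_derive_scale (is_derive_cosh (w1 * y)))).
by rewrite /S1; field.
Qed.

Let dS1 y : is_derive y (1:R) S1 (C1 y).
Proof.
have := is_deriveZ w1^-1 (is_derive_scale (is_derive_sinh (w1 * y))).
by move=> d; apply: (is_derive_eq d); rewrite /= /GRing.scale/= mulKf.
Qed.

Let CS1 y : C1 y * C1 y - w1 ^+ 2 * (S1 y * S1 y) = 1.
Proof. by rewrite -(cosh2_sinh2 (w1 * y)) /C1 /S1; field. Qed.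

Let dC2 y : is_derive y (1:R) C2 (- w2 ^+ 2 * S2 y).
Proof.
apply: (is_derive_eq (is_derive_scale (is_derive_cos (w2 * y)))).
by rewrite /S2; field.
Qed.

Let dS2 y : is_derive y (1:R) S2 (C2 y).
Proof.
have := is_deriveZ w2^-1 (is_derive_scale (is_derive_sin (w2 * y))).
by move=> d; apply: (is_derive_eq d); rewrite /= /GRing.scale/= mulKf.
Qed.

Let CS2 y : C2 y * C2 y - (- w2 ^+ 2) * (S2 y * S2 y) = 1.
Proof. by rewrite -(cos2Dsin2 (w2 * y)) /C2 /S2; field. Qed.

Let R0 f := resolvent C2 S2 (- w2 ^+ 2) (resolvent C1 S1 (w1 ^+ 2) f).

Let bounded_op_R0 : bounded_op R0.
Proof.
apply: bounded_op_comp (bounded_op_resolvent dC2 dS2) _.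
exact: bounded_op_resolvent dC1 dS1.
Qed.

(** Expanding the two factors gives D / delta: [sumE] matches the V^2 term and [prodE] the V^4
    term. *)
Let R0K f x : rL2 f -> 0 <= x <= 1 ->
  delta * R0 f x + s * V (V (R0 f)) x + -1 * V (V (V (V (R0 f)))) x = delta * f x.
Proof.
move=> f2 Ix; set h := R0 f; set k := resolvent C1 S1 (w1 ^+ 2) f.
have k2 : rL2 k := rL2_op (bounded_op_resolvent dC1 dS1) f2.
have h2 : rL2 h := rL2_op bounded_op_R0 f2.
have r2 := @rL2_V R.
have kE y : 0 <= y <= 1 -> k y = h y + w2 ^+ 2 * V (V h) y.
  by move=> Iy; rewrite -(resolventK dC2 dS2 CS2 k2 Iy) mulNr opprK.
have Vk y : 0 <= y <= 1 -> V k y = V h y + w2 ^+ 2 * V (V (V h)) y.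
  by move=> Iy; rewrite (eq_V Iy kE) (VD _ Iy h2 (r2 _ (r2 _ h2))).
have VVk : V (V k) x = V (V h) x + w2 ^+ 2 * V (V (V (V h))) x.
  by rewrite (eq_V Ix Vk) (VD _ Ix (r2 _ h2) (r2 _ (r2 _ (r2 _ h2)))).
rewrite -(resolventK dC1 dS1 CS1 f2 Ix) -/k VVk (kE x Ix) sumE.
generalize (h x), (V (V h) x), (V (V (V (V h))) x) => a b c.
have -> : -1 * c = - (delta * w1 ^+ 2 * w2 ^+ 2) * c by rewrite prodE.
ring.
Qed.

(** Cramer's rule for [solve0 * m00 + solve1 * m10 = bc1] and [solve0 * m01 + solve1 * m11 = - bc0],
    with the boundary terms taken at [R0 f], so that these cancel in q(G f, .). *)
Let solve0 f := (m11 * bc1 sigma tau (R0 f) + m10 * bc0 sigma tau (R0 f)) / det.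
Let solve1 f := (- m00 * bc0 sigma tau (R0 f) - m01 * bc1 sigma tau (R0 f)) / det.
Let G f x := R0 f x + 1 * (solve0 f * e0 x) + 1 * (solve1 f * e1 x).

Let bounded_op_VR0 : bounded_op (fun f => V (R0 f)).
Proof. exact: bounded_op_comp (@bounded_op_V R) bounded_op_R0. Qed.

Let bounded_op_VVR0 : bounded_op (fun f => V (V (R0 f))).
Proof. exact: bounded_op_comp (@bounded_op_V R) bounded_op_VR0. Qed.

Let bounded_op_VVVR0 : bounded_op (fun f => V (V (V (R0 f)))).
Proof. exact: bounded_op_comp (@bounded_op_V R) bounded_op_VVR0. Qed.

Let bounded_functional_bc a b : bounded_functional (fun f =>
  a * bc0 sigma tau (R0 f) + b * bc1 sigma tau (R0 f)).
Proof.
apply: bounded_functional_add.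
  have := bounded_functional_add 1 tau (bounded_functional_add 1 sigma
   (bounded_functional_V1 bounded_op_VVR0) (bounded_functional_V1 bounded_op_VR0))
   (bounded_functional_V1 bounded_op_R0).
  move=> [M [M0 lM]]; exists M; split => // f /lM.
  by rewrite !mul1r.
have := bounded_functional_add 1 (sigma * tau) (bounded_functional_add (-1) (s + tau)
   (bounded_functional_V1 bounded_op_VVVR0) (bounded_functional_V1 bounded_op_VR0))
   (bounded_functional_V1 bounded_op_R0).
move=> [M [M0 lM]]; exists M; split => // f /lM.
by rewrite mul1r mulN1r.
Qed.

Let bounded_op_G : bounded_op G.
Proof.
apply: (@bounded_op_add R _ _ 1); last first.
  apply: bounded_op_rank1 e12.
  have [M [M0 lM]] := bounded_functional_bc (- m00 / det) (- m01 / det).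
  exists M; split => // f /lM.
  by rewrite (_ : _ + _ = solve1 f)// /solve1; move: (det^-1) => u; ring.
apply: (@bounded_op_add R _ _ 1) => //.
apply: bounded_op_rank1 e02.
have [M [M0 lM]] := bounded_functional_bc (m10 / det) (m11 / det).
exists M; split => // f /lM.
by rewrite (_ : _ + _ = solve0 f)// /solve0; move: (det^-1) => u; ring.
Qed.

Let GK f g : det != 0 -> rL2 f -> rL2 g -> qform (G f) g = delta * ip f g.
Proof.
move=> det0 f2 g2.
have R2 : rL2 (R0 f) := rL2_op bounded_op_R0 f2.
have se0 : rL2 (fun x => solve0 f * e0 x) by exact: rL2Z.
have se1 : rL2 (fun x => solve1 f * e1 x) by exact: rL2Z.
rewrite /G qformDl//; last exact: rL2D.
rewrite qformDl// !qformZl// (qform_ext0 sumE prodE g2) (qform_ext1 sumE prodE g2).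
rewrite (qformE R2 g2 (fun x Ix => R0K f2 Ix)) ipZl// /solve0 /solve1.
move: det0; generalize m00, m01, m10, m11, (bc0 sigma tau (R0 f)),
  (bc1 sigma tau (R0 f)), (ip f g), (V g 1), (V (V g) 1).
by move=> *; field.
Qed.

Lemma qform_coercive : det != 0 -> (forall f, rL2 f -> 0 <= qform f f) ->
  exists2 e, 0 < e & forall f, rL2 f -> e * ip f f <= qform f f.
Proof.
move=> det0 q0; have [M [M0 GM]] := bounded_op_G.
(* q(G f, G f) = delta <f, G f> is at most delta (||f||^2 + ||G f||^2) / 2, hence at most N
   ||f||^2. *)
pose N := delta * (1 + M) / 2.
have N0 : 0 < N by rewrite /N divr_gt0 // mulr_gt0 // ltr_wpDr.
exists (delta ^+ 2 / N); first by rewrite divr_gt0// exprn_gt0.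
move=> f f2; have [Gf2 GfM] := GM _ f2.
have GGN : qform (G f) (G f) <= N * ip f f.
  rewrite GK//.
  have := ip_ge0 (fun x => f x + (-1) * G f x).
  have f12 := rL2D (-1) f2 Gf2.
  rewrite (ipDl _ f2 Gf2 f12) (ipDr _ f2 Gf2 f2) (ipDr _ f2 Gf2 Gf2) (ipC (G f) f).
  move: GfM N0; rewrite /N; generalize (ip f f), (ip f (G f)), (ip (G f) (G f)).
  move: delta_gt0 => d0 i j k kM _ jk.
  have : delta * (k - M * i) <= 0 by rewrite pmulr_rle0// subr_le0.
  have : 0 <= delta * (i + -1 * j + -1 * (j + -1 * k)) by rewrite pmulr_rge0.
  by nra.
(* This t maximizes 2 t delta - t^2 N, the resulting lower bound for q(f, f) / ||f||^2; the maximum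
   is delta^2 / N. *)
pose t := delta / N.
have f12 := rL2D (- t) f2 Gf2.
have := q0 _ f12.
rewrite (qformDl _ _ _ _ f2 Gf2 f12) !(qformC _ _ _ _ (fun x => f x + - t * G f x)).
rewrite (qformDl _ _ _ _ f2 Gf2 f2) (qformDl _ _ _ _ f2 Gf2 Gf2).
rewrite (qformC _ _ _ f (G f)) [qform (G f) f]GK//.
move: GGN N0 delta_gt0; rewrite /t.
generalize (ip f f), (qform f f), (qform (G f) (G f)) => i q r rN N0 d0.
have : (delta / N) ^+ 2 * r <= (delta / N) ^+ 2 * (N * i) by rewrite ler_wpM2l ?sqr_ge0.
have -> : (delta / N) ^+ 2 * (N * i) = delta ^+ 2 / N * i by field; rewrite gt_eqF.
have -> : q + - (delta / N) * (delta * i) + - (delta / N) * (delta * i + - (delta / N) * r) =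
  q - 2 * (delta ^+ 2 / N * i) + (delta / N) ^+ 2 * r by field; rewrite gt_eqF.
by lra.
Qed.

End Eigenvalues.

(** * The lower bound |tau| for the norm *)

Section EssentialNorm.
Context {R : realType}.
Local Notation mu := (@lebesgue_measure R).
Local Notation I := (`[0%R, 1%R]%classic : set R).
Variables sigma tau : R.
Implicit Types (f h : R -> R) (x e : R).

Lemma V_ge0 f x : (forall y, 0 <= y <= 1 -> 0 <= f y) -> 0 <= x <= 1 -> 0 <= V f x.
Proof.
move=> f0 Ix; rewrite VE; apply: Rintegral_ge0 => y /(sub_I Ix).
by rewrite I_itv; exact: f0.
Qed.

Lemma V_le1 f x : rL2 f -> (forall y, 0 <= y <= 1 -> 0 <= f y) -> 0 <= x <= 1 ->
  V f x <= V f 1.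
Proof.
move=> f2 f0 /andP[x0 x1]; rewrite -subr_ge0 !VE.
rewrite Rintegral_itvB ?bnd_simp//; last exact: rL2_integrable.
apply: Rintegral_ge0 => y /=; rewrite in_itv/= => /andP[xy y1].
by apply: f0; rewrite y1 (le_trans x0 (ltW xy)).
Qed.

Lemma V_indic e : 0 < e <= 1 -> V (\1_(`[0, e]) : R -> R) 1 = e.
Proof.
move=> /andP[e0 e1]; rewrite VE /Rintegral integral_indic//=.
rewrite setIidl; last first.
  by move=> y; rewrite /= !in_itv/= => /andP[-> ye]; rewrite (le_trans ye).
by rewrite lebesgue_measure_itv/= lte_fin e0 /= subr0.
Qed.

Lemma rL2_indic e : rL2 (\1_(`[0, e]) : R -> R).
Proof.
apply: (@rL2_bounded _ _ 1).
  exact: measurable_indic.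
by move=> x _; rewrite indicE; case: (_ \in _); rewrite ?normr1 ?normr0.
Qed.

(* On the indicator of [0, e], whose squared norm is [e], [pVr - tau] is [O(e)]. *)
Lemma sqr_tau_le nu2 : (forall f, rL2 f ->
    ip (pVr sigma tau f) (pVr sigma tau f) <= nu2 * ip f f) ->
  tau ^+ 2 <= nu2.
Proof.
move=> nuP; rewrite leNgt; apply/negP => ltnu.
(* For f the indicator of [0, e], T f - tau f is at most (1 + |sigma|) e in absolute value and f has
   integral e, so the cross term in ||T f||^2 is at most c e^2. *)
pose c := 2 * `|tau| * (1 + `|sigma|).
have c0 : 0 <= c by rewrite !mulr_ge0// addr_ge0.
suff H e : 0 < e <= 1 -> tau ^+ 2 - c * e <= nu2.
  pose d := tau ^+ 2 - nu2; have d0 : 0 < d by rewrite subr_gt0.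
  (* This choice gives both e <= 1 and c e < d. *)
  pose e := d / (1 + c + d).
  have den : 0 < 1 + c + d by rewrite addr_gt0// ltr_wpDr.
  have e01 : 0 < e <= 1 by rewrite divr_gt0//= ler_pdivrMr// mul1r lerDr addr_ge0.
  have := H _ e01; rewrite lerBlDl -lerBlDr -/d /e => /(le_trans _) H'.
  have : c * e < d by rewrite /e mulrA ltr_pdivrMr// mulrC ltr_pM2l//; lra.
  by rewrite ltNge (H' _ (lexx _)).
move=> e01; have /andP[e0 e1] := e01.
pose f := \1_(`[0, e]) : R -> R.
have f2 : rL2 f by exact: rL2_indic.
have f01 x : f x = 0 \/ f x = 1.
  by rewrite /f indicE; case: (_ \in _); [right|left].
have f0 x : 0 <= f x by case: (f01 x) => ->.
have Vf2 := rL2_V f2; have VVf2 := rL2_V Vf2.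
have ff : ip f f = e.
  rewrite -[RHS](V_indic e01) -ip1; apply/esym.
  rewrite !ipE; apply: eq_Rintegral => x _; rewrite mul1r -/f.
  by case: (f01 x) => ->; rewrite ?mulr0 ?mulr1.
have Vfe x : 0 <= x <= 1 -> 0 <= V f x <= e.
  by move=> Ix; rewrite V_ge0//= -(V_indic e01) V_le1.
have VVfe x : 0 <= x <= 1 -> 0 <= V (V f) x <= e.
  move=> Ix; have Vf0 y : 0 <= y <= 1 -> 0 <= V f y by move=> /Vfe/andP[].
  rewrite V_ge0//=; apply: (le_trans (V_le1 Vf2 Vf0 Ix)).
  rewrite -ip1; have -> : e = ip (cst 1) (cst e) by rewrite ip1 V_cst ?mulr1.
  apply: le_ip => //; try exact: rL2_cst.
  by move=> y /Vfe /andP[_ ?]; rewrite !mul1r.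
pose r x := V (V f) x + sigma * V f x.
have r2 : rL2 r by exact: rL2D.
have re x : 0 <= x <= 1 -> `|r x| <= (1 + `|sigma|) * e.
  move=> Ix; have /andP[a0 ae] := Vfe x Ix; have /andP[b0 be] := VVfe x Ix.
  rewrite (le_trans (ler_normD _ _))// normrM (ger0_norm a0) (ger0_norm b0).
  by rewrite mulrDl mul1r lerD// ler_wpM2l.
have fr : `|ip r f| <= (1 + `|sigma|) * e * e.
  have f2' := rL2Z ((1 + `|sigma|) * e) f2; have f2'' := rL2Z (- ((1 + `|sigma|) * e)) f2.
  have c1 := rL2_cst (1 : R).
  have E : e = ip f (cst 1) by rewrite ipC ip1 V_indic.
  rewrite ler_norml [X in _ * X]E -mulNr -!ipZl//; apply/andP; split.
  - apply: le_ip => // x Ix; rewrite /= mulr1 ler_wpM2r//.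
    by have := re x Ix; rewrite ler_norml => /andP[].
  - apply: le_ip => // x Ix; rewrite /= mulr1 ler_wpM2r//.
    by have := re x Ix; rewrite ler_norml => /andP[].
have := nuP _ f2.
have T2 : rL2 (pVr sigma tau f) := rL2_op (bounded_op_pVr _ _) f2.
have -> : ip (pVr sigma tau f) (pVr sigma tau f) =
   ip r r + 2 * tau * ip r f + tau ^+ 2 * ip f f.
  have E : pVr sigma tau f = (fun x => r x + tau * f x) by [].
  rewrite E in T2 *.
  rewrite (ipDl _ r2 f2 T2) (ipDr _ r2 f2 r2) (ipDr _ r2 f2 f2) (ipC f r); ring.
(* The goal is multiplied by e = ||f||^2, and the nonnegative [ip r r] is dropped. *)
rewrite ff => h; rewrite -(ler_pM2r e0); apply: le_trans h.
have := ip_ge0 r.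
have : - (2 * tau * ip r f) <= c * e * e.
  rewrite (le_trans (ler_norm _))// normrN !normrM (ger0_norm (ler0n _ 2)) /c -!mulrA.
  by rewrite ler_wpM2l// ler_wpM2l// !mulrA.
by move=> *; lra.
Qed.

End EssentialNorm.

(** * The complex operator norm in terms of real functions *)

Section OperatorNorm.
Context {R : realType}.
Local Notation mu := (@lebesgue_measure R).
Local Notation I := (`[0%R, 1%R]%classic : set R).
Variables sigma tau : R.
Implicit Types (f : R -> R[i]) (h : R -> R) (x : R).

Let re f x : R := complex.Re (f x).
Let im f x : R := complex.Im (f x).

Lemma re_pV f x : re (pV sigma tau f) x = pVr sigma tau (re f) x.
Proof.
rewrite /pVr !VE /re /pV /volterra /=.
case: (f x) => a b /=; rewrite !mul0r !subr0.
by rewrite V.unlock.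
Qed.

Lemma im_pV f x : im (pV sigma tau f) x = pVr sigma tau (im f) x.
Proof.
rewrite /pVr !VE /im /pV /volterra /=.
case: (f x) => a b /=; rewrite !mul0r !addr0.
by rewrite V.unlock.
Qed.

Lemma sqr_normc (z : R[i]) :
  Normc.normc z ^+ 2 = complex.Re z ^+ 2 + complex.Im z ^+ 2.
Proof. by case: z => a b /=; rewrite sqr_sqrtr// addr_ge0 ?sqr_ge0. Qed.

Lemma L2normE f : rL2 (re f) -> rL2 (im f) ->
  L2norm f = (Num.sqrt (ip (re f) (re f) + ip (im f) (im f)))%:E.
Proof.
move=> r2 i2; rewrite /L2norm.
have -> : (\int[mu]_(x in `[0%R, 1%R]) (Normc.normc (f x) ^+ 2)%:E)%E =
    (ip (re f) (re f) + ip (im f) (im f))%:E.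
  rewrite !ipE -RintegralD//; [|exact: rL2_integrableM..].
  rewrite -EFin_Rintegral//; last by apply: integrable_add => //; exact: rL2_integrableM.
  by apply: eq_integral => x _; rewrite sqr_normc !expr2.
by rewrite poweR_EFin powR12_sqrt// addr_ge0// ip_ge0.
Qed.

Lemma inL2P f : inL2 f <-> rL2 (re f) /\ rL2 (im f).
Proof.
split=> [[mr mi fin]|[r2 i2]]; last first.
  by split; [case: r2|case: i2|rewrite L2normE// ltry].
have fin2 : (\int[mu]_(x in `[0%R, 1%R]) (Normc.normc (f x) ^+ 2)%:E < +oo)%E.
  by apply: lty_poweRy fin; rewrite invr_eq0.
have mr' : measurable_fun (I : set (measurableTypeR R)) (re f) by exact: mr.
have mi' : measurable_fun (I : set (measurableTypeR R)) (im f) by exact: mi.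
have int2 : mu.-integrable I (EFin \o (fun x => Normc.normc (f x) ^+ 2)).
  apply/integrableP; split.
    apply/measurable_EFinP.
    have -> : (fun x => Normc.normc (f x) ^+ 2) = (fun x => re f x ^+ 2 + im f x ^+ 2).
      by apply/funext => x; exact: sqr_normc.
    by apply: measurable_funD; exact: measurable_funX.
  by under eq_integral do rewrite gee0_abs ?lee_fin ?sqr_ge0//.
split; split => //.
- apply: (integrable_dominated _ _ _ int2) => //; first exact: measurable_funX.
  by move=> x _; rewrite sqr_normc ger0_norm ?sqr_ge0// lerDl sqr_ge0.
- apply: (integrable_dominated _ _ _ int2) => //; first exact: measurable_funX.
  by move=> x _; rewrite sqr_normc ger0_norm ?sqr_ge0// lerDr sqr_ge0.
Qed.

Let rL2_pVr h : rL2 h -> rL2 (pVr sigma tau h).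
Proof. exact: rL2_op (bounded_op_pVr _ _). Qed.

Let L2norm_pV f : inL2 f -> L2norm (pV sigma tau f) =
  (Num.sqrt (ip (pVr sigma tau (re f)) (pVr sigma tau (re f)) +
             ip (pVr sigma tau (im f)) (pVr sigma tau (im f))))%:E.
Proof.
move=> /inL2P[r2 i2].
have Er : re (pV sigma tau f) = pVr sigma tau (re f) by apply/funext => x; exact: re_pV.
have Ei : im (pV sigma tau f) = pVr sigma tau (im f) by apply/funext => x; exact: im_pV.
by rewrite L2normE ?Er ?Ei//; exact: rL2_pVr.
Qed.

Let ip_cst0 : ip (cst 0 : R -> R) (cst 0) = 0.
Proof.
rewrite ipE (@eq_Rintegral _ _ _ _ _ (cst 0)) ?Rintegral_cst ?mul0r//.
by move=> x _; rewrite mulr0.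
Qed.

(** Squared norms of real and imaginary parts add, so a bound valid for each part carries over. *)
Lemma opnorm_pV_le a : 0 <= a ->
  (forall h, rL2 h -> ip (pVr sigma tau h) (pVr sigma tau h) <= a * ip h h) ->
  (opnorm (pV sigma tau) <= (Num.sqrt a)%:E)%E.
Proof.
move=> a0 ha; apply: ub_ereal_sup => _ [f [f2 f1] <-].
have [r2 i2] := (inL2P f).1 f2.
rewrite L2norm_pV// lee_fin ler_wsqrtr//.
move: f1; rewrite L2normE// lee_fin => f1.
have {}f1 : ip (re f) (re f) + ip (im f) (im f) <= 1.
  by rewrite -ler_sqrt ?ler01// sqrtr1.
rewrite (le_trans (lerD (ha _ r2) (ha _ i2)))// -mulrDr.
by rewrite -[leRHS]mulr1 ler_wpM2l.
Qed.

Lemma opnorm_pV_real : exists2 nu, 0 <= nu & opnorm (pV sigma tau) = nu%:E.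
Proof.
have [M [M0 TM]] := bounded_op_pVr sigma tau.
have ltoo : (opnorm (pV sigma tau) <= (Num.sqrt M)%:E)%E.
  by apply: opnorm_pV_le => // h /TM[].
(* The zero function lies in the unit ball, so the supremum is over a nonempty set of nonnegative
   values. *)
have ge0 : (0 <= opnorm (pV sigma tau))%E.
  apply: (@le_trans _ _ (L2norm (pV sigma tau (fun=> 0)))).
    exact: poweR_ge0.
  have z2 : rL2 (re (fun=> 0)) by exact: (rL2_cst 0).
  have y2 : rL2 (im (fun=> 0)) by exact: (rL2_cst 0).
  apply: ereal_sup_ubound; exists (fun=> 0) => //; split; first exact/inL2P.
  rewrite L2normE// lee_fin.
  have -> : re (fun=> 0) = cst 0 by [].
  have -> : im (fun=> 0) = cst 0 by [].
  rewrite ip_cst0.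
  by rewrite addr0 sqrtr0 ler01.
exists (fine (opnorm (pV sigma tau))); first exact: fine_ge0.
by rewrite fineK// ge0_fin_numE// (le_lt_trans ltoo)// ltry.
Qed.

Lemma ip_pVr_le nu h : 0 <= nu -> opnorm (pV sigma tau) = nu%:E -> rL2 h ->
  ip (pVr sigma tau h) (pVr sigma tau h) <= nu ^+ 2 * ip h h.
Proof.
move=> nu0 opE h2; have [h0|h0] := leP (ip h h) 0.
  (* A function of norm zero cannot be normalized; boundedness of [pVr] settles this case. *)
  have {}h0 : ip h h = 0 by apply/le_anti; rewrite h0 ip_ge0.
  have [M [_ TM]] := bounded_op_pVr sigma tau.
  by have [_] := TM _ h2; rewrite h0 !mulr0.
pose c := (Num.sqrt (ip h h))^-1.
have c2 : c ^+ 2 = (ip h h)^-1 by rewrite /c exprVn sqr_sqrtr// ltW.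
(* The normalized [h], viewed as a complex function with zero imaginary part. *)
pose f : R -> R[i] := fun x => (c * h x)%:C%C.
have ref : re f = (fun x => c * h x) by [].
have imf : im f = cst 0 by [].
have ch2 : rL2 (fun x => c * h x) by exact: rL2Z.
have z2 : rL2 (cst 0 : R -> R) by exact: rL2_cst.
have f2 : inL2 f by apply/inL2P; rewrite ref imf.
have ipZ2 (g : R -> R) : rL2 g -> ip (fun x => c * g x) (fun x => c * g x) = c ^+ 2 * ip g g.
  by move=> g2; rewrite ipZl 1?ipC ?ipZl ?mulrA//; exact: rL2Z.
have TcE x : 0 <= x <= 1 -> pVr sigma tau (fun x => c * h x) x = c * pVr sigma tau h x.
  move=> Ix; rewrite /pVr; have VZ' y : 0 <= y <= 1 -> V (fun x => c * h x) y = c * V h y.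
    by move=> Iy; exact: VZ.
  by rewrite (eq_V Ix VZ') VZ' ?VZ//; [ring|exact: rL2_V].
have : (L2norm (pV sigma tau f) <= nu%:E)%E.
  rewrite -opE; apply: ereal_sup_ubound; exists f => //; split => //.
  rewrite L2normE ?ref ?imf// ip_cst0 addr0 ipZ2// c2 mulVf ?gt_eqF//.
  by rewrite sqrtr1.
rewrite L2norm_pV// ref imf lee_fin (eq_ip TcE TcE) ipZ2; last exact: rL2_pVr.
(* [j] comes from the zero imaginary part and is discarded by its sign. *)
set j := ip (pVr _ _ (cst 0)) _; have j0 : 0 <= j by exact: ip_ge0.
have i0 : 0 <= c ^+ 2 * ip (pVr sigma tau h) (pVr sigma tau h).
  by rewrite mulr_ge0 ?sqr_ge0 ?ip_ge0.
rewrite -[X in (_ <= X) -> _](ger0_norm nu0) -sqrtr_sqr ler_sqrt ?sqr_ge0// => le1.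
rewrite -ler_pdivrMr// mulrC -c2; apply: le_trans le1.
by rewrite lerDl.
Qed.

End OperatorNorm.

(** * The frequencies w1, w2 and the characteristic equation *)

Section CharacteristicFunction.
Context {R : realType}.
Implicit Types sigma tau delta s w : R.

(** The square of w is the root (r - s) / (2 delta) of delta z^2 + s z - 1, positive since the root
    r of the discriminant exceeds s. *)
Lemma biquadratic_root_exists s delta : 0 < delta ->
  exists2 w, 0 < w & delta * w ^+ 4 + s * w ^+ 2 - 1 = 0.
Proof.
move=> d0; have D0 : 0 <= s ^+ 2 + 4 * delta by have := sqr_ge0 s; lra.
pose r := Num.sqrt (s ^+ 2 + 4 * delta).
have r2 : r ^+ 2 = s ^+ 2 + 4 * delta by rewrite sqr_sqrtr.
have rs : s < r.
  have [sn|sp] := ltP s 0; first by rewrite (lt_le_trans sn)// sqrtr_ge0.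
  rewrite -(ger0_norm sp) -sqrtr_sqr ltr_sqrt ?ltrDl ?mulr_gt0//.
  by have := sqr_ge0 s; lra.
pose z := (r - s) / (2 * delta).
have z0 : 0 < z by rewrite divr_gt0 ?subr_gt0 ?mulr_gt0.
exists (Num.sqrt z); first by rewrite sqrtr_gt0.
have -> : Num.sqrt z ^+ 4 = z ^+ 2 by rewrite (exprM _ 2 2) sqr_sqrtr// ltW.
rewrite sqr_sqrtr ?ltW//.
transitivity ((r ^+ 2 - s ^+ 2) / (4 * delta) - 1).
  by rewrite /z; field; rewrite gt_eqF.
by rewrite r2; field; rewrite gt_eqF.
Qed.

(** Multiplying the equations by w^2 and v^2 and subtracting eliminates s and leaves (v^2 -
    w^2)(delta v^2 w^2 + 1) = 0. *)
Lemma biquadratic_root_unique s delta v w : 0 < delta -> 0 < v -> 0 < w ->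
  delta * v ^+ 4 + s * v ^+ 2 - 1 = 0 -> delta * w ^+ 4 + s * w ^+ 2 - 1 = 0 ->
  v = w.
Proof.
move=> d0 v0 w0 ev ew.
suff : v ^+ 2 = w ^+ 2.
  by move/eqP; rewrite eqf_sqr => /orP[/eqP//|/eqP vw]; move: v0; rewrite vw oppr_gt0 ltNge ltW.
have v2 : 0 < v ^+ 2 by rewrite exprn_gt0.
have w2 : 0 < w ^+ 2 by rewrite exprn_gt0.
have : (v ^+ 2 - w ^+ 2) * (delta * v ^+ 2 * w ^+ 2 + 1) = 0.
  transitivity (w ^+ 2 * (delta * v ^+ 4 + s * v ^+ 2 - 1) -
    v ^+ 2 * (delta * w ^+ 4 + s * w ^+ 2 - 1)).
    by ring.
  by rewrite ev ew !mulr0 subrr.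
move/eqP; rewrite mulf_eq0 subr_eq0 => /orP[/eqP//|/eqP abs].
have : 0 < delta * v ^+ 2 * w ^+ 2 + 1 by rewrite addr_gt0// !mulr_gt0.
by rewrite abs ltxx.
Qed.

Lemma omega1_unique sigma tau delta : 0 < delta ->
  exists! w : R, is_omega1 sigma tau delta w.
Proof.
move=> d0; have [w w0 ew] := biquadratic_root_exists (sigma ^+ 2 - 2 * tau) d0.
exists w; split => // v [v0 ev]; exact: biquadratic_root_unique ew ev.
Qed.

Lemma omega2_unique sigma tau delta : 0 < delta ->
  exists! w : R, is_omega2 sigma tau delta w.
Proof.
move=> d0; have [w w0 ew] := biquadratic_root_exists (- (sigma ^+ 2 - 2 * tau)) d0.
rewrite mulNr in ew; exists w; split => // v [v0 ev].
by apply: (@biquadratic_root_unique (- (sigma ^+ 2 - 2 * tau)) delta) => //; rewrite mulNr.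
Qed.

(** These are Vieta's relations: w1^2 and - w2^2 are the two roots of delta z^2 + s z - 1. *)
Lemma omegaP sigma tau delta (w1 := omega1 sigma tau delta)
    (w2 := omega2 sigma tau delta) : 0 < delta ->
  [/\ 0 < w1, 0 < w2,
      sigma ^+ 2 - 2 * tau = delta * (w2 ^+ 2 - w1 ^+ 2) &
      delta * w1 ^+ 2 * w2 ^+ 2 = 1].
Proof.
move=> d0.
have [w1_gt0 e1] : is_omega1 sigma tau delta w1.
  by have [w [ew _]] := omega1_unique sigma tau d0; apply: (@xgetPex _ 0 _); exists w.
have [w2_gt0 e2] : is_omega2 sigma tau delta w2.
  by have [w [ew _]] := omega2_unique sigma tau d0; apply: (@xgetPex _ 0 _); exists w.
have sum0 : 0 < w1 ^+ 2 + w2 ^+ 2 by rewrite addr_gt0// exprn_gt0.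
have sumE : sigma ^+ 2 - 2 * tau = delta * (w2 ^+ 2 - w1 ^+ 2).
  apply: (mulfI (lt0r_neq0 sum0)); apply/eqP; rewrite -subr_eq0; apply/eqP.
  rewrite -[RHS](subrr 0) -[X in _ = X - _]e1 -[X in _ = _ - X]e2; ring.
split => //; rewrite -(subrK 1 (_ * _)) -[RHS]add0r; congr (_ + _).
by rewrite -[RHS]e1 sumE; ring.
Qed.

Lemma char_funE sigma tau delta (w1 := omega1 sigma tau delta)
    (w2 := omega2 sigma tau delta) :
  char_fun sigma tau delta =
  m00 sigma tau delta w1 w2 * m11 sigma tau delta w1 w2 -
  m10 sigma tau delta w1 w2 * m01 sigma tau delta w1 w2.
Proof. by rewrite /char_fun /m00 /m01 /m10 /m11 -/w1 -/w2; ring. Qed.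

Lemma positive_solution_opnorm sigma tau delta nu :
  0 <= nu -> opnorm (pV sigma tau) = nu%:E ->
  positive_solution sigma tau delta -> tau ^+ 2 + delta <= nu ^+ 2.
Proof.
move=> nu0 opE [d0]; rewrite char_funE => det0.
have [w1_gt0 w2_gt0 sumE prodE] := omegaP sigma tau d0.
have [h [h2 hpos] /eqP] := eigenfunction d0 w1_gt0 w2_gt0 sumE prodE det0.
rewrite /qform subr_eq0 => /eqP hE.
by rewrite -(ler_pM2r hpos) hE; exact: ip_pVr_le.
Qed.

(** Were the determinant nonzero, coercivity with constant e would lower the bound on ||T||^2 from
    nu^2 to nu^2 - e. *)
Lemma opnorm_positive_solution sigma tau nu :
  0 <= nu -> opnorm (pV sigma tau) = nu%:E ->
  tau ^+ 2 < nu ^+ 2 -> positive_solution sigma tau (nu ^+ 2 - tau ^+ 2).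
Proof.
move=> nu0 opE; rewrite -subr_gt0; set delta := nu ^+ 2 - tau ^+ 2 => d0.
split => //; rewrite char_funE; apply/eqP/negPn/negP => det0.
have [w1_gt0 w2_gt0 sumE prodE] := omegaP sigma tau d0.
have dE : tau ^+ 2 + delta = nu ^+ 2 by rewrite addrC subrK.
have [|e e0 He] := qform_coercive d0 w1_gt0 w2_gt0 sumE prodE det0.
  by move=> f f2; rewrite /qform dE subr_ge0; exact: ip_pVr_le.
(* The maximum keeps the radicand nonnegative; nu^2 <= 0 is excluded by nu^2 > tau^2. *)
pose a := Num.max 0 (nu ^+ 2 - e).
have a0 : 0 <= a by rewrite le_max lexx.
have : (opnorm (pV sigma tau) <= (Num.sqrt a)%:E)%E.
  apply: opnorm_pV_le => // h h2; have := He _ h2; rewrite /qform dE => le1.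
  apply: (@le_trans _ _ ((nu ^+ 2 - e) * ip h h)); first by rewrite mulrBl; lra.
  by rewrite ler_wpM2r ?ip_ge0// le_max lexx orbT.
rewrite opE lee_fin -{1}(ger0_norm nu0) -sqrtr_sqr ler_sqrt//.
rewrite /a le_max leNgt => /orP[|].
  by rewrite (le_lt_trans (sqr_ge0 tau))// -subr_gt0.
by rewrite lerBrDr gerDl leNgt e0.
Qed.

End CharacteristicFunction.

(** * The norm formula for p(V) *)

Unset Implicit Arguments.

Theorem theorem3p1 (R : realType) (sigma tau : R) :
  (forall delta : R, 0 < delta ->
     (exists! w : R, is_omega1 sigma tau delta w) /\
     (exists! w : R, is_omega2 sigma tau delta w)) /\
  ((exists delta : R, positive_solution sigma tau delta) ->
     exists delta : R, largest_positive_solution sigma tau delta /\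
       opnorm (pV sigma tau) = (Num.sqrt (tau ^+ 2 + delta))%:E) /\
  (~ (exists delta : R, positive_solution sigma tau delta) ->
     opnorm (pV sigma tau) = `|tau|%:E).
Proof.
have [nu nu0 opE] := opnorm_pV_real sigma tau.
have tau_nu : tau ^+ 2 <= nu ^+ 2.
  by apply: (@sqr_tau_le _ sigma) => f f2; exact: ip_pVr_le.
split; [|split].
- by move=> delta d0; split; [exact: omega1_unique|exact: omega2_unique].
- move=> [delta sol]; have [d0 _] := sol.
  have le_nu := positive_solution_opnorm nu0 opE sol.
  (* Every positive solution is at most this number, and the given one makes it positive, hence
     itself a solution. *)
  exists (nu ^+ 2 - tau ^+ 2); split; last first.
    by rewrite addrC subrK sqrtr_sqr ger0_norm.
  split; last first.
    move=> delta' /(positive_solution_opnorm nu0 opE).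
    by rewrite lerBrDl.
  apply: (opnorm_positive_solution nu0 opE).
  by apply: lt_le_trans le_nu; rewrite ltrDl.
- move=> nosol; rewrite opE; congr EFin.
  have : nu ^+ 2 = tau ^+ 2.
    apply/le_anti; rewrite tau_nu andbT leNgt; apply/negP => lt_nu.
    by apply: nosol; exists (nu ^+ 2 - tau ^+ 2); exact: opnorm_positive_solution.
  by move=> /(congr1 Num.sqrt); rewrite !sqrtr_sqr (ger0_norm nu0).
Qed.
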